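(* Let $(\iota,\Psi,F_t)$ be a formal ternary law over a graded $\mathbb Z[1/2]$-algebra $R$, let $\mu=\mathbb G(\iota,\Psi,F_t)$, and set $$p:=\mu(x,y),\qquad q:=\mu(x,\iota(y)),\qquad s:=[1/2](p),\qquad r:=[1/2](q).$$ Then $F_t(x,y,z)$ splits with roots $$B(s,z),\quad B(\iota(s),z),\quad B(r,\iota(z)),\quad B(\iota(r),\iota(z)),$$ i.e. $F_t(x,y,z)=(1+B(s,z)t)(1+B(\iota(s),z)t)(1+B(r,\iota(z))t)(1+B(\iota(r),\iota(z))t)$. Moreover, $\iota(x)$ is the formal inverse of $\mu$, and the series $[2](x)=f(x,0)$ is the $2$-series of $\mu$, that is, $[2](x)=\mu(x,x)$.
   Context: Graded rings are commutative. Over a graded $\mathbb Z[1/2]$-algebra $R$: Framed involution. A framed involution $(\iota,\Psi)$ over $R$ is a power series $\Psi(t)=t+O(t^2)\in R[[t]]$, $|t|=-2$, homogeneous of degree $-2$, with $\iota(t):=t-2\Psi(t)$ satisfying $\iota(\iota(t))=t$. (Over general graded rings one imposes the ''$2$-saturated'' version of this equation and of the axioms below, i.e. the coefficients must satisfy all polynomial relations some $2$-power multiple of which lies in the ideal generated by the stated ones; over $\mathbb Z[1/2]$-algebras this is the same.) Series. An $(m,n)$-series over $R$ is an element $G_t=1+\sum_{l=1}^mG_l(x_1,\dots,x_n)t^l$ of $R[[x_1,\dots,x_n]][t]$ homogeneous of degree $0$, where $|x_i|=-2$, $|t|=2$. When $G_t(0,\dots,0)=1$, write $G_t=\prod_i(1+r_it)$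 in a splitting algebra. Substitution is rootwise: $F_t(G_t,u,v):=\prod_iF_t(r_i,u,v)$. For $\Phi(x)=x+O(x^2)$ homogeneous of degree $-2$, the transport is $(\Phi_*G)_t=\prod_i\bigl(1+\Phi(r_i(\Phi^{-1}(x_1),\dots,\Phi^{-1}(x_n)))t\bigr)$. Formal ternary law. A formal ternary law (FTL) over $R$ with framed involution $(\iota,\Psi)$ is a $(4,3)$-series $F_t(x,y,z)=1+\sum_{l=1}^4F_lt^l$ over $R$ such that: (1) $F_t(x,0,0)=(1+xt)^2(1+\iota(x)t)^2$; (2) $F_t$ is symmetric in $x,y,z$; (3) $F_t(F_t(x,y,z),u,v)=F_t(x,F_t(y,z,u),v)$; (4) $\widehat F_t:=\Psi_*F_t$ satisfies $\widehat F_t(-x,y,z)=\widehat F_{-t}(x,y,z)$; (5) $F_t(x,x,y)=(1+yt)^2(1+S(x,y)t+P(x,y)t^2)$ for some $S,P\in R[[x,y]]$. The series $B,f,[2],[1/2]$ and $\mathbb G$. Here $S=F_1(x,x,y)-2y$ and $P=F_2(x,x,y)-2yS-y^2$. The series $D:=S^2-4P$ is divisible by $x^2$ and $\equiv16x^2$ mod $(x,y)^3$, so it has a unique square root $\sqrt D=4x\sqrt{D/(16x^2)}\equiv4x$ mod $(x,y)^2$ (binomial series). Put $B(x,y):=\tfrac12(S-\sqrt D)$; $f(x,y):=B(\iota(x),\iota(y))$; $[2](x):=f(x,0)\equiv2x$ mod $x^2$; $[1/2](x)$ is the compositional inverse of $[2](x)$. Then $\mathbb G(\iota,\Psi,F_t)$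 is the formal group law $\mu(x,y):=f([1/2](x),y)$. *)

(* Defs.v *)
From HB Require Import structures.
From mathcomp Require Import all_boot all_order all_algebra.
From mathcomp Require Import perm mpoly.
From mathcomp Require Import boolp classical_sets.
Set Implicit Arguments.
Unset Strict Implicit.
Unset Printing Implicit Defensive.
Import GRing.Theory.
Local Open Scope ring_scope.

(** * Formal power series in [n] commuting variables

A series is its family of coefficients, indexed by the exponents ['X_{1..n}]
of [mpoly]; polynomials serve in the proofs as truncations.  Decidable equality
and choice are classical. *)

Record mps (R : Type) (n : nat) := Mps { mps_coef :> 'X_{1..n} -> R }.

HB.instance Definition _ (R : Type) (n : nat) := gen_eqMixin (mps R n).
HB.instance Definition _ (R : Type) (n : nat) := gen_choiceMixin (mps R n).

Lemma mpsP (R : Type) (n : nat) (f g : mps R n) : (forall m, f m = g m) -> f = g.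
Proof. by case: f => f; case: g => g /= /funext ->. Qed.

Section Ring.
Context {R : comNzRingType} {n : nat}.
Implicit Types (f g h : mps R n) (m : 'X_{1..n}).

Definition mpsC (c : R) : mps R n := Mps (fun m => if m == 0%MM then c else 0).
Definition mps_add f g : mps R n := Mps (fun m => f m + g m).
Definition mps_opp f : mps R n := Mps (fun m => - f m).
Definition mps_mul f g : mps R n := Mps (fun m =>
  \sum_(k : 'X_{1..n < (mdeg m).+1, (mdeg m).+1} | m == (k.1 + k.2)%MM)
     f k.1 * g k.2).

Fact mps_addA : associative mps_add.
Proof. by move=> f g h; apply: mpsP => m /=; rewrite addrA. Qed.
Fact mps_addC : commutative mps_add.
Proof. by move=> f g; apply: mpsP => m /=; rewrite addrC. Qed.
Fact mps_add0 : left_id (mpsC 0) mps_add.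
Proof. by move=> f; apply: mpsP => m /=; rewrite if_same add0r. Qed.
Fact mps_addN : left_inverse (mpsC 0) mps_opp mps_add.
Proof. by move=> f; apply: mpsP => m /=; rewrite if_same addNr. Qed.

HB.instance Definition _ :=
  GRing.isZmodule.Build (mps R n) mps_addA mps_addC mps_add0 mps_addN.

Definition mps_trunc b f : {mpoly R[n]} :=
  \sum_(k : 'X_{1..n < b}) f k *: 'X_[k].

Lemma mcoeff_trunc b f m : (mdeg m < b)%N -> (mps_trunc b f)@_m = f m.
Proof. exact: mcoeff_mpoly. Qed.

Lemma mps_mulE f g (p q : {mpoly R[n]}) m :
  (forall k, (mdeg k <= mdeg m)%N -> p@_k = f k) ->
  (forall k, (mdeg k <= mdeg m)%N -> q@_k = g k) ->
  mps_mul f g m = (p * q)@_m.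
Proof.
move=> hp hq; rewrite mcoeffM; apply: eq_bigr => k _.
by rewrite hp ?hq // -ltnS bmdeg.
Qed.

Lemma mps_mul_truncE b f g m : (mdeg m < b)%N ->
  mps_mul f g m = (mps_trunc b f * mps_trunc b g)@_m.
Proof. by move=> hm; apply: mps_mulE => k hk; rewrite mcoeff_trunc // (leq_ltn_trans hk). Qed.

Fact mps_mulA : associative mps_mul.
Proof.
move=> f g h; apply: mpsP => m; have lt k : (mdeg k <= mdeg m -> mdeg k < (mdeg m).+1)%N by [].
rewrite (@mps_mulE _ _ (mps_trunc (mdeg m).+1 f)
  (mps_trunc (mdeg m).+1 g * mps_trunc (mdeg m).+1 h)); first last.
- by move=> k /lt hk; rewrite -mps_mul_truncE.
- by move=> k /lt hk; rewrite mcoeff_trunc.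
rewrite mulrA -(@mps_mulE (mps_mul f g) h) //.
- by move=> k /lt hk; rewrite -mps_mul_truncE.
- by move=> k /lt hk; rewrite mcoeff_trunc.
Qed.

Fact mps_mulC : commutative mps_mul.
Proof.
by move=> f g; apply: mpsP => m; rewrite !(@mps_mul_truncE (mdeg m).+1) // mulrC.
Qed.

Fact mps_mul1 : left_id (mpsC 1) mps_mul.
Proof.
move=> f; apply: mpsP => m.
rewrite (@mps_mulE _ _ 1 (mps_trunc (mdeg m).+1 f)).
- by rewrite mul1r mcoeff_trunc.
- by move=> k _; rewrite mcoeff1 /=; case: eqP.
- by move=> k hk; rewrite mcoeff_trunc.
Qed.

Fact mps_mulDl : left_distributive mps_mul mps_add.
Proof.
move=> f g h; apply: mpsP => m /=; rewrite -big_split /=.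
by apply: eq_bigr => k _; rewrite mulrDl.
Qed.

Fact mps_one_neq0 : mpsC 1 != mpsC 0.
Proof.
apply/eqP => /(congr1 (fun f : mps R n => f 0%MM)) /= /eqP.
by rewrite eqxx oner_eq0.
Qed.

HB.instance Definition _ := GRing.Zmodule_isComNzRing.Build (mps R n)
  mps_mulA mps_mulC mps_mul1 mps_mulDl mps_one_neq0.

Definition mpsX (i : 'I_n) : mps R n := Mps (fun m => (m == U_(i)%MM)%:R).

End Ring.

(* The [k]-th (from 0) of [n] variables; [k < n] is checked by computation. *)
Notation var n k := (mpsX (@Ordinal n k isT)).

(* Substitution [f(g_1, ..., g_n)].  It has its mathematical meaning when the
   [g_i] have no constant term; then only the monomials of [f] of degree at most
   [mdeg m] contribute to the coefficient at [m]. *)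
Definition mps_comp (R : comNzRingType) (n p : nat)
    (f : mps R n) (g : n.-tuple (mps R p)) : mps R p :=
  Mps (fun m => \sum_(k : 'X_{1..n < (mdeg m).+1})
                   f k * (\prod_(i < n) tnth g i ^+ k i) m).

(* The same for the coefficients of a polynomial in [t]. *)
Definition mps_pcomp (R : comNzRingType) (n p : nat)
    (F : {poly (mps R n)}) (g : n.-tuple (mps R p)) : {poly (mps R p)} :=
  map_poly (fun f => mps_comp f g) F.

(* The inverse for composition of [f = a x + O(x^2)], [a] a unit. *)
Definition comp_inverse (R : comNzRingType) (f : mps R 1) : mps R 1 :=
  xget 0 (fun g : mps R 1 =>
    [/\ g 0%MM = 0, mps_comp f [tuple g] = var 1 0
      & mps_comp g [tuple f] = var 1 0]).

(** * Graded rings and homogeneous series *)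

Record grading (R : comNzRingType) := Grading {
  gr :> int -> set R;
  gr0 : forall d, gr d 0;
  grB : forall d a b, gr d a -> gr d b -> gr d (a - b);
  gr1 : gr 0 1;
  grM : forall d e a b, gr d a -> gr e b -> gr (d + e) (a * b);
  gr_span : forall a, exists (s : seq int) (c : int -> R),
    [/\ uniq s, forall d, gr d (c d) & a = \sum_(d <- s) c d];
  gr_free : forall (s : seq int) (c : int -> R),
    uniq s -> (forall d, gr d (c d)) -> \sum_(d <- s) c d = 0 ->
    forall d, d \in s -> c d = 0 }.

(* Every variable has degree -2, so the coefficient at [m] of a series of degree
   [d] has degree [d + 2 mdeg m]. *)
Definition homogeneous (R : comNzRingType) (A : grading R) (n : nat) (d : int)
    (f : mps R n) : Prop :=
  forall m : 'X_{1..n}, A (d + (mdeg m).*2%:Z) (f m).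

(* The variable of the polynomial is [t], of degree 2. *)
Definition is_series (R : comNzRingType) (A : grading R) (m n : nat)
    (G : {poly (mps R n)}) : Prop :=
  [/\ G`_0 = 1, (size G <= m.+1)%N
    & forall l, homogeneous A (- (l.*2%:Z)) G`_l].

(** * Rootwise substitution

[rootwise m G P K] states that [K = \prod_i P(x, r_i)], where
[G = \prod_(i < m) (1 + r_i t)] with [G(0) = 1]; the last variable of [P] stands
for the root.  The equation is taken in the splitting algebra
[R[[x_1, ..., x_n, r_1, ..., r_m]] / (G - \prod_i (1 + r_i t))] of [G] over
[R[[x_1, ..., x_n]]], in which series in the roots converge.  This algebra is the
base change along [e_l |-> G_l] of [R[[r]]] over its symmetric series [R[[e]]],
hence free with 1 in a basis, so exactly one such [K] exists. *)
Definition rootwise (R : comNzRingType) (n m : nat)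
    (G : {poly (mps R n)}) (P : {poly (mps R n.+1)}) (K : {poly (mps R n)}) : Prop :=
  let x : n.-tuple (mps R (n + m)) := [tuple mpsX (lshift m i) | i < n] in
  let r (j : 'I_m) : mps R (n + m) := mpsX (rshift n j) in
  let rel := mps_pcomp G x - \prod_(j < m) (1 + r j *: 'X) in
  let err := mps_pcomp K x - \prod_(j < m) mps_pcomp P [tuple of rcons x (r j)] in
  forall k, exists c : 'I_m.+1 -> mps R (n + m),
    err`_k = \sum_(l < m.+1) c l * rel`_l.

(* [H] is the transport [Phi_* G] of the [(m, n)]-series [G]. *)
Definition is_transport (R : comNzRingType) (m n : nat) (Phi : mps R 1)
    (G H : {poly (mps R n)}) : Prop :=
  rootwise m
    (mps_pcomp G [tuple mps_comp (comp_inverse Phi) [tuple mpsX i] | i < n])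
    (1 + mps_comp Phi [tuple mpsX ord_max] *: 'X) H.

(** * Formal ternary laws

The axioms are the unsaturated ones, hence meant for rings in which 2 is
invertible. *)

Record framed_involution (R : comNzRingType) (A : grading R)
    (iota Psi : mps R 1) : Prop := FramedInvolution {
  framed_const : Psi 0%MM = 0;
  framed_lin : Psi U_(ord0)%MM = 1;
  framed_homog : homogeneous A (- 2%:Z) Psi;
  framed_iota : iota = var 1 0 - 2%:R * Psi;
  framed_invol : mps_comp iota [tuple iota] = var 1 0 }.

Record formal_ternary_law (R : comNzRingType) (A : grading R)
    (iota Psi : mps R 1) (F : {poly (mps R 3)}) : Prop := FormalTernaryLaw {
  ftl_framed : framed_involution A iota Psi;
  ftl_series : is_series A 4 F;
  ftl_unit :
    mps_pcomp F [tuple var 1 0; 0; 0]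
    = (1 + var 1 0 *: 'X) ^+ 2 * (1 + iota *: 'X) ^+ 2;
  ftl_sym : forall s : 'S_3, mps_pcomp F [tuple mpsX (s i) | i < 3] = F;
  ftl_assoc :
    let x : mps R 5 := var 5 0 in let y : mps R 5 := var 5 1 in
    let z : mps R 5 := var 5 2 in let u : mps R 5 := var 5 3 in
    let x' : mps R 6 := var 6 0 in let u' : mps R 6 := var 6 3 in
    let v' : mps R 6 := var 6 4 in let root : mps R 6 := var 6 5 in
    exists K : {poly (mps R 5)},
      rootwise 4 (mps_pcomp F [tuple x; y; z]) (mps_pcomp F [tuple root; u'; v']) K
      /\ rootwise 4 (mps_pcomp F [tuple y; z; u]) (mps_pcomp F [tuple x'; root; v']) K;
  ftl_reflect :
    exists2 Fhat : {poly (mps R 3)}, is_transport 4 Psi F Fhat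
      & mps_pcomp Fhat [tuple - var 3 0; var 3 1; var 3 2] = Fhat \Po (- 'X);
  ftl_diag :
    exists S P : mps R 2,
      mps_pcomp F [tuple var 2 0; var 2 0; var 2 1]
      = (1 + var 2 1 *: 'X) ^+ 2 * (1 + S *: 'X + P *: 'X^2) }.

(** * The series [B], [f], [[2]], [[1/2]] and [mu] *)

Section Series.
Context {R : comUnitRingType}.
Variables (iota : mps R 1) (F : {poly (mps R 3)}).

Let x : mps R 2 := var 2 0.
Let y : mps R 2 := var 2 1.

Definition ftl_S : mps R 2 := mps_comp F`_1 [tuple x; x; y] - 2%:R * y.
Definition ftl_P : mps R 2 :=
  mps_comp F`_2 [tuple x; x; y] - 2%:R * y * ftl_S - y ^+ 2.
Definition ftl_D : mps R 2 := ftl_S ^+ 2 - 4%:R * ftl_P.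

(* The square root of [D] congruent to [4 x] modulo [(x, y)^2]. *)
Definition ftl_sqrtD : mps R 2 :=
  xget 0 (fun s : mps R 2 =>
    s ^+ 2 = ftl_D
    /\ forall m : 'X_{1..2}, (mdeg m < 2)%N -> s m = (4%:R * x : mps R 2) m).

Definition ftl_B : mps R 2 := mpsC (2%:R)^-1 * (ftl_S - ftl_sqrtD).
Definition ftl_f : mps R 2 :=
  mps_comp ftl_B [tuple mps_comp iota [tuple x]; mps_comp iota [tuple y]].
Definition ftl_two : mps R 1 := mps_comp ftl_f [tuple var 1 0; 0].
Definition ftl_half : mps R 1 := comp_inverse ftl_two.

(* The formal group law [G(iota, Psi, F)]; it depends on [Psi] only through [iota]. *)
Definition ftl_mu : mps R 2 :=
  mps_comp ftl_f [tuple mps_comp ftl_half [tuple x]; y].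

End Series.

Definition is_formal_inverse (R : comNzRingType) (mu : mps R 2) (i : mps R 1) : Prop :=
  [/\ i 0%MM = 0, mps_comp mu [tuple var 1 0; i] = 0
    & mps_comp mu [tuple i; var 1 0] = 0].

Definition two_series (R : comNzRingType) (mu : mps R 2) : mps R 1 :=
  mps_comp mu [tuple var 1 0; var 1 0].

(* Main.v *)
(* All identities are used at "points": series without constant term, in any number of
   variables.  Write [i] for [iota].  Associativity at [(x, 0, 0, y, z)] only involves
   values of [F] that split, and gives [F(ix, y, z)^2 = F(x, iy, z)^2], hence
   [F(ix, y, z) = F(x, iy, z)] since 2 is invertible.  So [S], [P] and [D] are invariant
   under [x |-> ix]; as [D(0, y) = 0], this makes [D] divisible by [x^2], and
   [F(x, x, y)] has the roots [y, y, B(x, y), B(ix, y)].  The reflection axiom gives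
   [B(ix, iy) = i B(x, y)].

   Associativity at [(v, x, x, 0, 0)] then shows that [F([2]x, 0, v)] is the square root of
   a known square, with roots [B(x, v)], [B(ix, v)] and their images under [i]; so
   [F(x, 0, v)] splits.  Comparing roots gives [mu(x, y) = mu(y, x)]; hence
   [mu(x, ix)] is fixed by [i], so it vanishes, and [mu(x, x) = [2]x].

   Finally associativity at [(x, y, 0, 0, z)] gives
   [F(x, y, z) F(x, iy, z) = F(p, 0, z) F(q, 0, z)], where the right-hand side splits.
   Each of the four announced series is a root of the right-hand side, and the value
   of [F(x, iy, z)] at it is a nonzerodivisor, as one sees by restricting to
   [x = y]; so it is a root of [F(x, y, z)].  The differences of the four roots have a linear
   coefficient +2 or -2, so they are nonzerodivisors and [F] is the product. *)

Require Import Defs.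
From HB Require Import structures.
From mathcomp Require Import all_boot all_order all_algebra all_fingroup.
From mathcomp Require Import mpoly zify ring.
From mathcomp Require classical_sets.
Set Implicit Arguments.
Unset Strict Implicit.
Unset Printing Implicit Defensive.
Import GRing.Theory.
Local Open Scope ring_scope.

(** * Coefficients of power series *)

Section Coefficients.
Context {R : comNzRingType} {n : nat}.
Implicit Types (f g h : mps R n) (m : 'X_{1..n}) (p : {mpoly R[n]}).

Lemma mps_coefD f g m : (f + g) m = f m + g m. Proof. by []. Qed.
Lemma mps_coefN f m : (- f) m = - f m. Proof. by []. Qed.
Lemma mps_coefB f g m : (f - g) m = f m - g m. Proof. by []. Qed.
Lemma mps_coef0 m : (0 : mps R n) m = 0. Proof. exact: if_same. Qed.

Lemma mps_coef_sum (I : Type) (r : seq I) (P : pred I) (F : I -> mps R n) m :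
  (\sum_(i <- r | P i) F i) m = \sum_(i <- r | P i) F i m.
Proof.
elim/big_rec2: _ => [|i y1 y2 _ <-]; first exact: mps_coef0.
by [].
Qed.

Definition mps_of_mpoly p : mps R n := Mps (fun m => p@_m).

Fact mps_of_mpoly_is_zmod_morphism : zmod_morphism mps_of_mpoly.
Proof. by move=> p q; apply: mpsP => m /=; rewrite mcoeffB. Qed.
Fact mps_of_mpoly_is_monoid_morphism : monoid_morphism mps_of_mpoly.
Proof.
split=> [|p q]; first by apply: mpsP => m /=; rewrite mcoeff1; case: eqP.
by apply: mpsP => m; rewrite [RHS](@mps_mulE _ _ _ _ p q).
Qed.
HB.instance Definition _ := GRing.isZmodMorphism.Build _ _ mps_of_mpoly
  mps_of_mpoly_is_zmod_morphism.
HB.instance Definition _ := GRing.isMonoidMorphism.Build _ _ mps_of_mpoly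
  mps_of_mpoly_is_monoid_morphism.

Lemma mpsC_mpoly c : mpsC c = mps_of_mpoly c%:MP.
Proof. by apply: mpsP => m /=; rewrite mcoeffC eq_sym mulrC; case: eqP; rewrite ?mul1r ?mul0r. Qed.

Lemma mpsX_mpoly i : mpsX i = mps_of_mpoly 'X_i.
Proof. by apply: mpsP => m /=; rewrite mcoeffX eq_sym. Qed.

Fact mpsC_is_zmod_morphism : zmod_morphism (@mpsC R n).
Proof. by move=> a b; rewrite !mpsC_mpoly !rmorphB. Qed.
Fact mpsC_is_monoid_morphism : monoid_morphism (@mpsC R n).
Proof. by split=> [|a b]; rewrite !mpsC_mpoly !(rmorph1, rmorphM). Qed.
HB.instance Definition _ := GRing.isZmodMorphism.Build _ _ (@mpsC R n)
  mpsC_is_zmod_morphism.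
HB.instance Definition _ := GRing.isMonoidMorphism.Build _ _ (@mpsC R n)
  mpsC_is_monoid_morphism.

Lemma mps_coefCM c f m : (mpsC c * f) m = c * f m.
Proof.
pose t := mps_trunc (mdeg m).+1 f.
rewrite [LHS](@mps_mulE _ _ _ _ c%:MP t) => [|k _|k hk].
- by rewrite mul_mpolyC mcoeffZ mcoeff_trunc.
- by rewrite mpsC_mpoly.
- by rewrite mcoeff_trunc.
Qed.

Lemma mps_coef0M f g : (f * g) 0%MM = f 0%MM * g 0%MM.
Proof.
rewrite [LHS](@mps_mulE _ _ _ _ (f 0%MM)%:MP (g 0%MM)%:MP) => [|k|k].
- by rewrite -mpolyCM mcoeffC eqxx mulr1.
- by rewrite mdeg0 leqn0 mdeg_eq0 => /eqP->; rewrite mcoeffC eqxx mulr1.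
- by rewrite mdeg0 leqn0 mdeg_eq0 => /eqP->; rewrite mcoeffC eqxx mulr1.
Qed.

Lemma mps_coefXM i f m : (mpsX i * f) (m + U_(i))%MM = f m.
Proof.
pose t := mps_trunc (mdeg (m + U_(i))%MM).+1 f.
rewrite [LHS](@mps_mulE _ _ _ _ 'X_i t) => [|k _|k hk].
- rewrite addmC mulrC mcoeffMX mcoeff_trunc //.
  by rewrite ltnS mdegD leq_addr.
- by rewrite mpsX_mpoly.
- by rewrite mcoeff_trunc.
Qed.

Lemma mps_coefXM0 i f m : m i = 0%N -> (mpsX i * f) m = 0.
Proof.
move=> mi; apply: big1 => k /eqP mE.
rewrite /= [k.1 == _ :> 'X_{1..n}]negbTE ?mul0r //; apply/eqP => kE.
by move: mi; rewrite mE mnmDE kE mnm1E eqxx.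
Qed.

Lemma mnm_le_mdeg m i : (m i <= mdeg m)%N.
Proof. by rewrite mdegE (bigD1 i) //= leq_addr. Qed.

(** The filtration by powers of the ideal generated by the variables. It stands in for the topology:
    limits and continuity are expressed through it. *)
Definition ord_ge d f := forall m, (mdeg m < d)%N -> f m = 0.

Lemma ord_geM a b f g : ord_ge a f -> ord_ge b g -> ord_ge (a + b) (f * g).
Proof.
move=> hf hg m hm; apply: big1 => k /eqP mE.
have [/hf->|ka] := ltnP (mdeg k.1) a; first by rewrite mul0r.
rewrite hg ?mulr0 // -(ltn_add2l (mdeg k.1)) -mdegD -mE.
by apply: leq_trans hm _; rewrite leq_add2r.
Qed.

Lemma ord_ge0 f : ord_ge 0 f. Proof. by []. Qed.

Lemma ord_ge1 f : f 0%MM = 0 -> ord_ge 1 f.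
Proof. by move=> f0 m; rewrite ltnS leqn0 mdeg_eq0 => /eqP->. Qed.

Lemma ord_geX k f : f 0%MM = 0 -> ord_ge k (f ^+ k).
Proof.
move=> f0; elim: k => [|k IH]; first exact: ord_ge0.
by rewrite exprS -add1n; apply: ord_geM IH; apply: ord_ge1.
Qed.

Lemma ord_ge_sum d (I : Type) (r : seq I) (P : pred I) (F : I -> mps R n) :
  (forall i, P i -> ord_ge d (F i)) -> ord_ge d (\sum_(i <- r | P i) F i).
Proof. by move=> hF m hm; rewrite mps_coef_sum big1 // => i /hF->. Qed.

Lemma ord_geD d f g : ord_ge d f -> ord_ge d g -> ord_ge d (f + g).
Proof. by move=> hf hg m hm; rewrite mps_coefD hf ?hg ?addr0. Qed.
Lemma ord_geN d f : ord_ge d f -> ord_ge d (- f).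
Proof. by move=> hf m hm; rewrite mps_coefN hf ?oppr0. Qed.

Lemma mps_trunc_ord d f : ord_ge d (f - mps_of_mpoly (mps_trunc d f)).
Proof. by move=> m hm; rewrite mps_coefB /= mcoeff_trunc ?subrr. Qed.

(** A contraction for the degree filtration: from the [k]-th one on, the iterates of [Phi] starting
    at 0 agree below degree [k], so the coefficient at [m] is final after [(mdeg m).+1] steps. *)
Lemma mps_fixpoint (Phi : mps R n -> mps R n) :
  (forall d f g, ord_ge d (f - g) -> ord_ge d.+1 (Phi f - Phi g)) ->
  exists f, Phi f = f.
Proof.
move=> hPhi; pose u k := iter k Phi 0.
have step k j : ord_ge k (u (k + j)%N - u k).
  elim: k => [|k IH]; first exact: ord_ge0.
  exact: hPhi IH.
exists (Mps (fun m => u (mdeg m).+1 m)); apply: mpsP => m /=.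
(* Agreement of the limit with [u (mdeg m)] below degree [mdeg m] suffices: one more application of
   [Phi] gains the degree of [m] itself. *)
have h : ord_ge (mdeg m) (Mps (fun m => u (mdeg m).+1 m) - u (mdeg m)).
  move=> k hk; rewrite mps_coefB /=; apply/eqP; rewrite subr_eq0 eq_sym -subr_eq0.
  by rewrite -mps_coefB -(subnKC hk) step.
by have /eqP := hPhi _ _ _ h m (ltnSn _); rewrite mps_coefB subr_eq0 => /eqP.
Qed.

(** Division by the [i]-th variable. Terms free of this variable are dropped, so it is a true
    quotient only when there are none, as in [mps_shiftE]. *)
Definition mps_shift (i : 'I_n) f : mps R n := Mps (fun m => f (m + U_(i))%MM).

Lemma mps_shiftE (i : 'I_n) f :
  (forall m, m i = 0%N -> f m = 0) -> f = mpsX i * mps_shift i f.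
Proof.
move=> hf; apply: mpsP => m; have [mi|mi] := posnP (m i).
  by rewrite hf // mps_coefXM0.
have mE : (m - U_(i) + U_(i) = m)%MM.
  by rewrite submK //; apply/mnm_lepP => j; rewrite mnm1E; case: eqP => [<-|].
by rewrite -mE mps_coefXM /= mE.
Qed.

Lemma mpsX_lreg i : GRing.lreg (mpsX i : mps R n).
Proof.
move=> f g fg; apply: mpsP => m.
by rewrite -(mps_coefXM i f) -(mps_coefXM i g) fg.
Qed.

(* The coefficient of [h * g] at [m + U_(i)], where [m] has minimal degree and then
   maximal [i]-th exponent in the support of [g], is [h U_(i) * g m]. *)
Lemma mps_lreg_lin h (i : 'I_n) :
  h 0%MM = 0 -> GRing.lreg (h U_(i)%MM) -> GRing.lreg h.
Proof.
move=> h0 hi; suff H g : h * g = 0 -> g = 0.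
  by move=> f g /eqP; rewrite -subr_eq0 -mulrBr => /eqP/H/eqP; rewrite subr_eq0 => /eqP.
move=> hg; apply: mpsP => m; rewrite mps_coef0.
have [d] := ubnP (mdeg m); elim: d m => // d IHd m; rewrite ltnS => md.
have [mdE|md0] := eqVneq (mdeg m) d; last first.
  by apply: IHd; rewrite ltn_neqAle md0.
move: {md} mdE => md.
have [e] := ubnP (d - m i); elim: e m md => // e IHe m md; rewrite ltnS => me.
apply: hi; rewrite mulr0.
transitivity ((h * g) (m + U_(i))%MM); last by rewrite hg mps_coef0.
have lt1 : (mdeg U_(i) < (mdeg (m + U_(i))%MM).+1)%N.
  by rewrite mdegD mdeg1 ltnS leq_addl.
have ltm : (mdeg m < (mdeg (m + U_(i))%MM).+1)%N by rewrite mdegD ltnS leq_addr.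
rewrite [RHS](bigD1 (BMultinom lt1, BMultinom ltm)) /=; last by rewrite addmC.
rewrite [X in _ + X]big1 ?addr0 // => [[k1 k2]] /= /andP[/eqP mE kne].
(* The other terms of the convolution vanish: for [k1 = 0] by [h0]; for [mdeg k1 > 1] because [k2]
   then has degree below [d]; for [k1 = U_(j)] with [j != i] because [k2] then has a larger [i]-th
   exponent than [m]. *)
have [k1_0|k1_pos] := posnP (mdeg k1).
  by move/eqP: k1_0; rewrite mdeg_eq0 => /eqP->; rewrite h0 mul0r.
have dE : (mdeg k1 + mdeg k2 = d + 1)%N by rewrite -mdegD -mE mdegD md mdeg1.
have [k1_1|] := eqVneq (mdeg k1) 1%N; last first.
  move=> k1_1; rewrite IHd ?mulr0 //.
  case: (mdeg k1) k1_pos k1_1 dE => [|[|a]] // _ _.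
  by rewrite addn1 addSn addSn => -[] <-; rewrite ltnS leq_addl.
have k2d : mdeg k2 = d by move: dE; rewrite k1_1 add1n addn1 => -[].
move/eqP: k1_1 => /mdeg1P[j /eqP k1E].
have [ji|ji] := eqVneq j i.
  case/eqP: kne; congr (_, _); apply/val_inj => /=; first by rewrite k1E ji.
  have uE : (m + U_(i) = U_(i) + k2)%MM.
    by rewrite [LHS]mE; congr (_ + _)%MM; rewrite k1E ji.
  exact: addmI (etrans (esym uE) (addmC _ _)).
rewrite IHe ?mulr0 //.
have k2i : (k2 : 'X_{1..n}) i = (m i).+1.
  have /mnmP/(_ i) := mE; rewrite !mnmDE k1E !mnm1E eqxx (negbTE ji) add0n.
  by rewrite addn1 => ->.
rewrite k2i; apply: leq_trans me; rewrite subnS prednK // subn_gt0.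
by rewrite -k2i -k2d mnm_le_mdeg.
Qed.

End Coefficients.

(** * Substitution *)

Section Composition.
Context {R : comNzRingType}.

Definition const_free n p (g : n.-tuple (mps R p)) :=
  all (fun a : mps R p => a 0%MM == 0) g.

Lemma const_freeP n p (g : n.-tuple (mps R p)) :
  reflect (forall i, tnth g i 0%MM = 0) (const_free g).
Proof.
apply: (iffP all_tnthP) => h i; first exact/eqP.
exact/eqP.
Qed.

Section Fixed.
Context {n p : nat}.
Implicit Types (f : mps R n) (g : n.-tuple (mps R p)) (q : {mpoly R[n]}).

Lemma mps_compB g f1 f2 : mps_comp (f1 - f2) g = mps_comp f1 g - mps_comp f2 g.
Proof.
apply: mpsP => m; rewrite mps_coefB /= -sumrB; apply: eq_bigr => k _.
exact: mulrBl.
Qed.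

Lemma mps_comp_ord_ge f g d : const_free g -> ord_ge d f -> ord_ge d (mps_comp f g).
Proof.
move=> hg hf m hm; apply: big1 => k _.
by rewrite hf ?mul0r //; apply: leq_trans hm; apply: bmdeg.
Qed.

(** A monomial of degree above [mdeg m] turns into a series of at least that order, so cutting the
    sum off at degree [mdeg m] loses nothing at [m]. *)
Lemma mps_comp_mpoly q g : const_free g ->
  mps_comp (mps_of_mpoly q) g = mmap (@mpsC R p) (tnth g) q.
Proof.
move=> /const_freeP hg; apply: mpsP => m; pose b := (mdeg m).+1.
have tE (r : {mpoly R[n]}) : (mmap (@mpsC R p) (tnth g) r) m =
    \sum_(k <- msupp r) r@_k * (\prod_(i < n) tnth g i ^+ k i) m.
  by rewrite mps_coef_sum; apply: eq_bigr => k _; rewrite mps_coefCM.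
pose t := mps_trunc b (mps_of_mpoly q).
have -> : mps_comp (mps_of_mpoly q) g m = (mmap (@mpsC R p) (tnth g) t) m.
  rewrite raddf_sum mps_coef_sum; apply: eq_bigr => k _ /=.
  by rewrite mmapZ mps_coefCM mmapX.
apply/eqP; rewrite -subr_eq0 -mps_coefB -raddfB tE big_seq big1 //= => k.
rewrite mcoeff_msupp mcoeffB => tk.
have [hk|hk] := ltnP (mdeg k) b.
  by case/eqP: tk; rewrite mcoeff_trunc //= subrr.
have : ord_ge (mdeg k) (\prod_(i < n) tnth g i ^+ k i).
  rewrite mdegE; elim/big_ind2: _ => [||i _].
  - exact: ord_ge0.
  - by move=> a1 f1 a2 f2; apply: ord_geM.
  - exact: ord_geX.
by move=> /(_ m hk) ->; rewrite mulr0.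
Qed.

(** Below any given degree both sides depend only on truncations of [f1] and [f2], and on
    polynomials substitution is the ring morphism [mmap]. *)
Lemma mps_compM g f1 f2 : const_free g ->
  mps_comp (f1 * f2) g = mps_comp f1 g * mps_comp f2 g.
Proof.
move=> hg; apply: mpsP => m; pose b := (mdeg m).+1.
pose T f := mps_of_mpoly (mps_trunc b f).
have hT f : ord_ge b (f - T f) by apply: mps_trunc_ord.
have split4 (S : comNzRingType) (a1 a2 b1 b2 : S) :
  a1 * a2 - b1 * b2 = (a1 - b1) * a2 + b1 * (a2 - b2).
  by ring.
have h1 : ord_ge b (mps_comp (f1 * f2) g - mps_comp (T f1 * T f2) g).
  rewrite -mps_compB; apply: mps_comp_ord_ge => //.
  rewrite split4; apply: ord_geD.
    by rewrite -[b]addn0; apply: ord_geM => //; apply: ord_ge0.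
  by rewrite -[b]add0n; apply: ord_geM => //; apply: ord_ge0.
have h2 : ord_ge b (mps_comp f1 g * mps_comp f2 g -
                    mps_comp (T f1) g * mps_comp (T f2) g).
  rewrite split4 -!mps_compB; apply: ord_geD.
    rewrite -[b]addn0; apply: ord_geM; last exact: ord_ge0.
    exact: mps_comp_ord_ge.
  rewrite -[b]add0n; apply: ord_geM; first exact: ord_ge0.
  exact: mps_comp_ord_ge.
have /eqP := h1 m (ltnSn _); have /eqP := h2 m (ltnSn _).
rewrite !mps_coefB !subr_eq0 => /eqP-> /eqP->.
by rewrite /T -rmorphM !mps_comp_mpoly //= rmorphM.
Qed.

Lemma mps_compC g c : mps_comp (mpsC c) g = mpsC c.
Proof.
apply: mpsP => m /=.
have lt0 : (mdeg (0%MM : 'X_{1..n}) < (mdeg m).+1)%N by rewrite mdeg0.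
rewrite (bigD1 (BMultinom lt0)) //= [X in _ + X]big1 ?addr0 => [|k kne].
  rewrite big1 => [|i _]; last by rewrite mnm0E expr0.
  by rewrite eqxx /=; case: eqP; rewrite ?mulr1 ?mulr0.
case: eqP => [k0|]; last by rewrite mul0r.
by case/eqP: kne; apply/val_inj.
Qed.

Lemma mps_compX g i : const_free g -> mps_comp (mpsX i) g = tnth g i.
Proof. by move=> hg; rewrite mpsX_mpoly mps_comp_mpoly //= mmapX mmap1U. Qed.

Lemma mps_comp_const f g : mps_comp f g 0%MM = f 0%MM.
Proof.
rewrite /=; have lt0 : (mdeg (0%MM : 'X_{1..n}) < (mdeg (0%MM : 'X_{1..p})).+1)%N.
  by rewrite mdeg0.
rewrite (bigD1 (BMultinom lt0)) //= [X in _ + X]big1 ?addr0 => [|k kne].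
  by rewrite big1 /= ?eqxx ?mulr1 //= => i _; rewrite mnm0E expr0.
case/eqP: kne; apply/val_inj => /=; apply/eqP; rewrite -mdeg_eq0 -leqn0.
by rewrite -ltnS -[X in (_ < X.+1)%N](@mdeg0 p); apply: bmdeg.
Qed.

(** Chain rule at the origin: modulo order 2, [f] is the affine polynomial [l]. *)
Lemma mps_comp_lin f g j : const_free g ->
  mps_comp f g U_(j)%MM = \sum_(i < n) f U_(i)%MM * tnth g i U_(j)%MM.
Proof.
move=> hg; pose l : {mpoly R[n]} := (f 0%MM)%:MP + \sum_(i < n) f U_(i)%MM *: 'X_i.
have /(mps_comp_ord_ge hg) : ord_ge 2 (f - mps_of_mpoly l).
  move=> m; rewrite ltnS leq_eqVlt ltnS leqn0 => /orP[/mdeg1P[i /eqP->]|].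
    rewrite mps_coefB /= mcoeffD mcoeffC mnm1_eq0 mulr0 add0r raddf_sum /=.
    rewrite (bigD1 i) //= big1 ?addr0 => [|k ki].
      by rewrite mcoeffZ mcoeffX eqxx mulr1 subrr.
    by rewrite mcoeffZ mcoeffXU (negbTE ki) mulr0.
  rewrite mdeg_eq0 => /eqP->; rewrite mps_coefB /= mcoeffD mcoeffC eqxx mulr1.
  rewrite raddf_sum /= big1 ?addr0 ?subrr // => i _.
  by rewrite mcoeffZ mcoeffX mnm1_eq0 mulr0.
rewrite mps_compB => /(_ U_(j)%MM); rewrite mdeg1 mps_coefB => /(_ isT)/eqP.
rewrite subr_eq0 mps_comp_mpoly // => /eqP->.
rewrite mmapD mmapC mps_coefD [mpsC _ _]/= mnm1_eq0 add0r raddf_sum mps_coef_sum.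
by apply: eq_bigr => i _; rewrite /= mmapZ mps_coefCM mmapX mmap1U.
Qed.

(** The proof [hg] is an argument so that substitution at [g] can be declared a ring morphism. *)
Definition mps_subst g (hg : const_free g) f := mps_comp f g.

Section Morphism.
Variables (g : n.-tuple (mps R p)) (hg : const_free g).

Fact mps_subst_is_zmod_morphism : zmod_morphism (mps_subst hg).
Proof. exact: mps_compB. Qed.
Fact mps_subst_is_monoid_morphism : monoid_morphism (mps_subst hg).
Proof. by split=> [|f1 f2]; [exact: mps_compC | exact: mps_compM]. Qed.
HB.instance Definition _ := GRing.isZmodMorphism.Build _ _ (mps_subst hg)
  mps_subst_is_zmod_morphism.
HB.instance Definition _ := GRing.isMonoidMorphism.Build _ _ (mps_subst hg)
  mps_subst_is_monoid_morphism.

Lemma mps_compN f : mps_comp (- f) g = - mps_comp f g.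
Proof. exact: (rmorphN (mps_subst hg)). Qed.
Lemma mps_compXn f k : mps_comp (f ^+ k) g = mps_comp f g ^+ k.
Proof. exact: (rmorphXn (mps_subst hg)). Qed.

End Morphism.

End Fixed.

Lemma eq_ord_ge n (f g : mps R n) : (forall d, ord_ge d (f - g)) -> f = g.
Proof.
move=> h; apply: mpsP => m; apply/eqP; rewrite -subr_eq0 -mps_coefB.
by rewrite (h (mdeg m).+1).
Qed.

(** Both sides are continuous in [f], so it suffices to treat truncations, where substitution
    commutes with finite sums and products. *)
Lemma mps_compA n p q (f : mps R n) (g : n.-tuple (mps R p)) (h : p.-tuple (mps R q)) :
  const_free g -> const_free h ->
  mps_comp (mps_comp f g) h = mps_comp f [tuple mps_comp (tnth g i) h | i < n].
Proof.
move=> hg hh.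
have hgh : const_free [tuple mps_comp (tnth g i) h | i < n].
  by apply/const_freeP => i; rewrite tnth_mktuple mps_comp_const; move/const_freeP: hg.
apply: eq_ord_ge => d; pose t := mps_trunc d f.
have ft : ord_ge d (f - mps_of_mpoly t) by apply: mps_trunc_ord.
have h1 := mps_comp_ord_ge hh (mps_comp_ord_ge hg ft).
have h2 := mps_comp_ord_ge hgh ft.
have E : mps_comp (mps_comp (mps_of_mpoly t) g) h
    = mps_comp (mps_of_mpoly t) [tuple mps_comp (tnth g i) h | i < n].
  rewrite !mps_comp_mpoly // -[LHS]/(mps_subst hh _) /mmap rmorph_sum.
  apply: eq_bigr => k _; rewrite rmorphM; congr (_ * _); first exact: mps_compC.
  rewrite rmorph_prod; apply: eq_bigr => i _.
  by rewrite rmorphXn tnth_mktuple.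
have := ord_geD h1 (ord_geN h2); rewrite !mps_compB E.
by rewrite opprB addrA subrK.
Qed.

Lemma mps_comp_id n (f : mps R n) : mps_comp f [tuple mpsX i | i < n] = f.
Proof.
have hx : const_free [tuple mpsX i : mps R n | i < n].
  by apply/const_freeP => i; rewrite tnth_mktuple /= eq_sym mnm1_eq0.
apply: eq_ord_ge => d; pose t := mps_trunc d f.
have ft : ord_ge d (f - mps_of_mpoly t) by apply: mps_trunc_ord.
have := ord_geD (mps_comp_ord_ge hx ft) (ord_geN ft).
suff E : mps_comp (mps_of_mpoly t) [tuple mpsX i | i < n] = mps_of_mpoly t.
  by rewrite mps_compB E opprB addrA subrK.
rewrite mps_comp_mpoly // /mmap [in RHS](mpolyE t) raddf_sum.
apply: eq_bigr => k _.
rewrite /= -mul_mpolyC rmorphM /= -mpsC_mpoly; congr (_ * _).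
rewrite mpolyXE_id rmorph_prod; apply: eq_bigr => i _.
by rewrite rmorphXn tnth_mktuple mpsX_mpoly.
Qed.

End Composition.

(** * Roots of polynomials in [t] *)

Lemma lreg_of_mul0 (S : comNzRingType) (a : S) :
  (forall b, a * b = 0 -> b = 0) -> GRing.lreg a.
Proof.
by move=> h b c /eqP; rewrite -subr_eq0 -mulrBr => /eqP/h/eqP; rewrite subr_eq0 => /eqP.
Qed.

Lemma lreg_mul0 (S : comNzRingType) (a b : S) : GRing.lreg a -> a * b = 0 -> b = 0.
Proof. by move=> ha hb; apply: ha; rewrite mulr0. Qed.

Section ReversedEvaluation.
Context {S : comNzRingType}.
Implicit Types (p q : {poly S}) (a r : S).

(** The coefficients of a polynomial killed by [p] vanish one after the other, starting from the
    lowest. *)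
Lemma lreg_poly_coef0 p : GRing.lreg p`_0 -> GRing.lreg p.
Proof.
move=> hp; apply: lreg_of_mul0 => q pq; apply/polyP => k; rewrite coef0.
elim/ltn_ind: k => k IH; apply: hp; rewrite mulr0.
transitivity ((p * q)`_k); last by rewrite pq coef0.
rewrite coefM big_ord_recl subn0 big1 ?addr0 // => i _.
by rewrite IH ?mulr0 // lift0 ltn_subrL /=; case: (k) i => [[]|].
Qed.

(** [(p - q) (p + q) = 0], and [p + q] is regular because its constant coefficient is 2. This is how
    square roots are extracted from associativity. *)
Lemma sqr_poly_inj p q : GRing.lreg (2%:R : S) ->
  p`_0 = 1 -> q`_0 = 1 -> p ^+ 2 = q ^+ 2 -> p = q.
Proof.
move=> h2 p0 q0 pq; apply/eqP; rewrite -subr_eq0; apply/eqP.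
apply: (@lreg_mul0 _ (p + q)); first by apply: lreg_poly_coef0; rewrite coefD p0 q0.
by rewrite mulrC -subr_sqr pq subrr.
Qed.

(* If [p = \prod_(i < d) (1 + a_i t)], then [rev_eval d p r = \prod_(i < d) (r - a_i)]. *)
Definition rev_eval d p r := \sum_(i < d.+1) (-1) ^+ i * p`_i * r ^+ (d - i).

Lemma rev_eval_lin a r : rev_eval 1 (1 + a *: 'X) r = r - a.
Proof.
rewrite /rev_eval big_ord_recl big_ord1 /= !coefD !coef1 !coefZ !coefX /=.
by ring.
Qed.

(** [rev_eval d p r] is [r^d p(-1/r)] written without division, hence multiplicative once the sizes
    bound the degrees by [d] and [e]. *)
Lemma rev_evalM d e p q r : (size p <= d.+1)%N -> (size q <= e.+1)%N ->
  rev_eval (d + e) (p * q) r = rev_eval d p r * rev_eval e q r.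
Proof.
move=> sp sq.
have E k (u : {poly S}) : (size u <= k.+1)%N -> u = \sum_(i < k.+1) u`_i *: 'X^i.
  move=> su; rewrite -poly_def; apply/polyP => i; rewrite coef_poly.
  by case: ltnP => // ki; rewrite nth_default // (leq_trans su).
have evD k (I : finType) (F : I -> {poly S}) :
    rev_eval k (\sum_i F i) r = \sum_i rev_eval k (F i) r.
  rewrite /rev_eval exchange_big /=; apply: eq_bigr => i _.
  by rewrite coef_sum mulr_sumr mulr_suml.
have evZX k c i : (i <= k)%N ->
    rev_eval k (c *: 'X^i) r = (-1) ^+ i * c * r ^+ (k - i).
  move=> ik; rewrite /rev_eval (bigD1 (Ordinal (ik : (i < k.+1)%N))) //=.
  rewrite big1 ?addr0 => [|j ji]; first by rewrite coefZ coefXn eqxx mulr1.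
  have /negbTE jiF : (j : nat) != i by [].
  by rewrite coefZ coefXn jiF !mulr0 mul0r.
rewrite {1}(E _ _ sp) {1}(E _ _ sq) mulr_suml evD mulr_suml.
apply: eq_bigr => i _; rewrite mulr_sumr evD mulr_sumr; apply: eq_bigr => j _.
have hi : (i <= d)%N by rewrite -ltnS.
have hj : (j <= e)%N by rewrite -ltnS.
rewrite -scalerAl -scalerAr scalerA -exprD evZX ?leq_add //.
have -> : (d + e - (i + j) = (d - i) + (e - j))%N by lia.
by rewrite !exprD; ring.
Qed.

(** Synthetic division: the [c k] are the coefficients of the power series [p / (1 + r t)], and the
    one in degree [d.+1] is, up to sign, the value of [rev_eval]. Once it vanishes, the quotient is
    a polynomial. *)
Lemma rev_eval_factor d p r : (size p <= d.+2)%N -> rev_eval d.+1 p r = 0 ->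
  exists2 q : {poly S}, (size q <= d.+1)%N & p = (1 + r *: 'X) * q.
Proof.
move=> sp pr; pose c k := \sum_(i < k.+1) p`_i * (- r) ^+ (k - i).
have c0 : c 0%N = p`_0 by rewrite /c big_ord1 mulr1.
have cS k : c k.+1 = p`_k.+1 - r * c k.
  rewrite /c big_ord_recr /= subnn mulr1 addrC; congr (_ + _).
  rewrite mulr_sumr -sumrN; apply: eq_bigr => i _.
  have ik : (i <= k)%N by rewrite -ltnS.
  by rewrite subSn // exprS; ring.
have cd : c d.+1 = 0.
  rewrite -[RHS](mulr0 ((-1) ^+ d.+1)) -pr /c /rev_eval mulr_sumr.
  apply: eq_bigr => i _; have id1 : (i <= d.+1)%N by rewrite -ltnS.
  have -> : (-1) ^+ d.+1 = (-1) ^+ (d.+1 - i) * (-1) ^+ i :> S.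
    by rewrite -exprD subnK.
  have ss : (-1) ^+ i * (-1) ^+ i = 1 :> S by rewrite -expr2 sqrr_sign.
  transitivity ((-1) ^+ i * (-1) ^+ i * (p`_i * (- r) ^+ (d.+1 - i))).
    by rewrite ss mul1r.
  rewrite (exprNn r); move: ((-1) ^+ i) ((-1) ^+ (d.+1 - i)) => u v.
  by ring.
exists (\poly_(i < d.+1) c i); first exact: size_poly.
apply/polyP => k; rewrite mulrDl mul1r -scalerAl coefD coefZ coefXM !coef_poly.
case: k => [|k] /=; first by rewrite mulr0 addr0 c0.
have [kd|kd|->] := ltngtP k d.
- by rewrite ltnS kd ltnS ltnW // cS subrK.
- rewrite ltnS ltnNge ltnW //= add0r ltnS leqNgt kd mulr0 nth_default //.
  by apply: leq_trans sp _.
- rewrite ltnn add0r ltnS leqnn; apply/eqP; rewrite -subr_eq0 -cS cd //.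
Qed.

Lemma size_lin a : (size (1 + a *: 'X : {poly S})%R <= 2)%N.
Proof.
apply: leq_trans (size_polyD _ _) _; rewrite geq_max size_poly1 /=.
by apply: leq_trans (size_scale_leq _ _) _; rewrite size_polyX.
Qed.

Lemma size_linM d a p : (size p <= d.+1)%N -> (size ((1 + a *: 'X) * p)%R <= d.+2)%N.
Proof.
move=> sp; apply: leq_trans (size_polyMleq _ _) _.
by move: (size_lin a) sp; move: (size _) (size _) => n k; lia.
Qed.

Lemma rev_eval_linM d a p r : (size p <= d.+1)%N ->
  rev_eval d.+1 ((1 + a *: 'X) * p) r = (r - a) * rev_eval d p r.
Proof. by move=> sp; rewrite -add1n rev_evalM ?rev_eval_lin ?size_lin. Qed.

(** The roots are split off one at a time: by regularity of the differences, each remaining root is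
    a root of the quotient. The last quotient is constant, hence 1 by comparison of constant
    coefficients. *)
Lemma lin_prod4_of_roots p r1 r2 r3 r4 : p`_0 = 1 -> (size p <= 5)%N ->
  rev_eval 4 p r1 = 0 -> rev_eval 4 p r2 = 0 ->
  rev_eval 4 p r3 = 0 -> rev_eval 4 p r4 = 0 ->
  GRing.lreg (r2 - r1) -> GRing.lreg (r3 - r1) -> GRing.lreg (r4 - r1) ->
  GRing.lreg (r3 - r2) -> GRing.lreg (r4 - r2) -> GRing.lreg (r4 - r3) ->
  p = (1 + r1 *: 'X) * (1 + r2 *: 'X) * (1 + r3 *: 'X) * (1 + r4 *: 'X).
Proof.
move=> p0 sp h1 h2 h3 h4 l21 l31 l41 l32 l42 l43.
have [q1 s1 p1E] := rev_eval_factor sp h1; rewrite p1E in p0 h2 h3 h4 *.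
move: h2 h3 h4; rewrite !rev_eval_linM //.
move=> /(lreg_mul0 l21) h2 /(lreg_mul0 l31) h3 /(lreg_mul0 l41) h4.
have [q2 s2 q1E] := rev_eval_factor s1 h2; rewrite q1E in p0 h3 h4 *.
move: h3 h4; rewrite !rev_eval_linM //.
move=> /(lreg_mul0 l32) h3 /(lreg_mul0 l42) h4.
have [q3 s3 q2E] := rev_eval_factor s2 h3; rewrite q2E in p0 h4 *.
move: h4; rewrite !rev_eval_linM // => /(lreg_mul0 l43) h4.
have [q4 s4 q3E] := rev_eval_factor s3 h4; rewrite q3E in p0 *.
suff -> : q4 = 1 by rewrite mulr1 !mulrA.
rewrite [q4]size1_polyC //; move: p0; rewrite !coef0M !coefD !coefZ !coefX !coef1 /=.
by rewrite !mulr0 !addr0 !mul1r => ->.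
Qed.

End ReversedEvaluation.

(** * Substitution in polynomials, and rootwise substitution *)

Section Substitution.
Context {R : comNzRingType}.

Lemma const_free1 p (a : mps R p) : a 0%MM = 0 -> const_free [tuple a].
Proof. by move=> a0; rewrite /const_free /= a0 eqxx. Qed.
Lemma const_free2 p (a b : mps R p) :
  a 0%MM = 0 -> b 0%MM = 0 -> const_free [tuple a; b].
Proof. by move=> a0 b0; rewrite /const_free /= a0 b0 !eqxx. Qed.
Lemma const_free3 p (a b c : mps R p) :
  a 0%MM = 0 -> b 0%MM = 0 -> c 0%MM = 0 -> const_free [tuple a; b; c].
Proof. by move=> a0 b0 c0; rewrite /const_free /= a0 b0 c0 !eqxx. Qed.

Lemma const_free4 p (a b c d : mps R p) :
  a 0%MM = 0 -> b 0%MM = 0 -> c 0%MM = 0 -> d 0%MM = 0 -> const_free [tuple a; b; c; d].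
Proof. by move=> a0 b0 c0 d0; rewrite /const_free /= a0 b0 c0 d0 !eqxx. Qed.
Lemma const_free5 p (a b c d e : mps R p) :
  a 0%MM = 0 -> b 0%MM = 0 -> c 0%MM = 0 -> d 0%MM = 0 -> e 0%MM = 0 ->
  const_free [tuple a; b; c; d; e].
Proof. by move=> a0 b0 c0 d0 e0; rewrite /const_free /= a0 b0 c0 d0 e0 !eqxx. Qed.

Lemma mps_comp_comp1 p q (f : mps R 1) (a : mps R p) (h : p.-tuple (mps R q)) :
  a 0%MM = 0 -> const_free h ->
  mps_comp (mps_comp f [tuple a]) h = mps_comp f [tuple mps_comp a h].
Proof.
move=> a0 hh; rewrite mps_compA //; last exact: const_free1.
congr mps_comp; apply: eq_from_tnth => i; rewrite tnth_mktuple.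
by case: i => [[|]].
Qed.

Lemma mps_comp_comp2 p q (f : mps R 2) (a b : mps R p) (h : p.-tuple (mps R q)) :
  a 0%MM = 0 -> b 0%MM = 0 -> const_free h ->
  mps_comp (mps_comp f [tuple a; b]) h = mps_comp f [tuple mps_comp a h; mps_comp b h].
Proof.
move=> a0 b0 hh; rewrite mps_compA //; last exact: const_free2.
congr mps_comp; apply: eq_from_tnth => i; rewrite tnth_mktuple.
by case: i => [[|[|]]].
Qed.

Lemma mps_comp_comp3 p q (f : mps R 3) (a b c : mps R p) (h : p.-tuple (mps R q)) :
  a 0%MM = 0 -> b 0%MM = 0 -> c 0%MM = 0 -> const_free h ->
  mps_comp (mps_comp f [tuple a; b; c]) h
  = mps_comp f [tuple mps_comp a h; mps_comp b h; mps_comp c h].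
Proof.
move=> a0 b0 c0 hh; rewrite mps_compA //; last exact: const_free3.
congr mps_comp; apply: eq_from_tnth => i; rewrite tnth_mktuple.
by case: i => [[|[|[|]]]].
Qed.

Lemma mps_comp_var1 (f : mps R 1) : mps_comp f [tuple var 1 0] = f.
Proof.
rewrite -[RHS]mps_comp_id; congr mps_comp; apply: eq_from_tnth => i.
by rewrite tnth_mktuple; case: i => [[|]] // ?; apply: congr1; apply: val_inj.
Qed.

Lemma mps_comp_var2 (f : mps R 2) : mps_comp f [tuple var 2 0; var 2 1] = f.
Proof.
rewrite -[RHS]mps_comp_id; congr mps_comp; apply: eq_from_tnth => i.
by rewrite tnth_mktuple; case: i => [[|[|]]] // ?; apply: congr1; apply: val_inj.
Qed.

Lemma mps_comp_var3 (f : mps R 3) : mps_comp f [tuple var 3 0; var 3 1; var 3 2] = f.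
Proof.
rewrite -[RHS]mps_comp_id; congr mps_comp; apply: eq_from_tnth => i.
by rewrite tnth_mktuple; case: i => [[|[|[|]]]] // ?; apply: congr1; apply: val_inj.
Qed.

Lemma mpsX_const n i : (mpsX i : mps R n) 0%MM = 0.
Proof. by rewrite /= eq_sym mnm1_eq0. Qed.

Lemma mpsX_lin n i j : (mpsX i : mps R n) U_(j)%MM = (i == j)%:R.
Proof. by rewrite mpsX_mpoly /= mcoeffXU. Qed.

Lemma mps_pcomp_coef n p (F : {poly (mps R n)}) (g : n.-tuple (mps R p)) k :
  (mps_pcomp F g)`_k = mps_comp F`_k g.
Proof. by rewrite coef_map_id0 // -(rmorph0 (@mpsC R n)) mps_compC rmorph0. Qed.

Lemma mps_pcomp_size n p (F : {poly (mps R n)}) (g : n.-tuple (mps R p)) d :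
  (size F <= d)%N -> (size (mps_pcomp F g) <= d)%N.
Proof. by move=> sF; apply: leq_trans (size_poly _ _) sF. Qed.

Section Fixed.
Context {n p : nat}.
Variables (g : n.-tuple (mps R p)) (hg : const_free g).
Implicit Types F G : {poly (mps R n)}.

Lemma mps_pcomp_subst F : mps_pcomp F g = map_poly (mps_subst hg) F.
Proof. by []. Qed.
Lemma mps_pcompM F G : mps_pcomp (F * G) g = mps_pcomp F g * mps_pcomp G g.
Proof. by rewrite !mps_pcomp_subst rmorphM. Qed.
Lemma mps_pcompXn F k : mps_pcomp (F ^+ k) g = mps_pcomp F g ^+ k.
Proof. by rewrite !mps_pcomp_subst rmorphXn. Qed.
Lemma mps_pcomp_prod (I : Type) (r : seq I) (P : pred I) (F : I -> {poly (mps R n)}) :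
  mps_pcomp (\prod_(i <- r | P i) F i) g = \prod_(i <- r | P i) mps_pcomp (F i) g.
Proof. by rewrite mps_pcomp_subst rmorph_prod. Qed.
Lemma mps_pcomp_lin a : mps_pcomp (1 + a *: 'X) g = 1 + mps_comp a g *: 'X.
Proof. by rewrite mps_pcomp_subst rmorphD rmorph1 /= map_polyZ map_polyX. Qed.
Lemma mps_comp_rev_eval d F r :
  mps_comp (rev_eval d F r) g = rev_eval d (mps_pcomp F g) (mps_comp r g).
Proof.
rewrite -/(mps_subst hg _) rmorph_sum; apply: eq_bigr => i _.
by rewrite mps_pcomp_coef !rmorphM rmorph_sign rmorphXn.
Qed.

End Fixed.

Lemma mps_pcomp_comp n p q (F : {poly (mps R n)}) (g : n.-tuple (mps R p))
    (h : p.-tuple (mps R q)) : const_free g -> const_free h ->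
  mps_pcomp (mps_pcomp F g) h = mps_pcomp F [tuple mps_comp (tnth g i) h | i < n].
Proof. by move=> hg hh; apply/polyP => k; rewrite !mps_pcomp_coef mps_compA. Qed.

Lemma mps_pcomp_comp3 p q (F : {poly (mps R 3)}) (a b c : mps R p)
    (h : p.-tuple (mps R q)) :
  a 0%MM = 0 -> b 0%MM = 0 -> c 0%MM = 0 -> const_free h ->
  mps_pcomp (mps_pcomp F [tuple a; b; c]) h
  = mps_pcomp F [tuple mps_comp a h; mps_comp b h; mps_comp c h].
Proof. by move=> *; apply/polyP => k; rewrite !mps_pcomp_coef mps_comp_comp3. Qed.

(** A choice of roots [r] at the point [a] is a morphism out of the splitting algebra: sending the
    variables to [a] and the formal roots to [r] kills the relations, so the equation characterising
    [K] holds at [a]. *)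
Lemma rootwise_split n m p (G K : {poly (mps R n)}) (P : {poly (mps R n.+1)})
    (a : n.-tuple (mps R p)) (r : m.-tuple (mps R p)) :
  rootwise m G P K -> const_free a -> const_free r ->
  mps_pcomp G a = \prod_(j < m) (1 + tnth r j *: 'X) ->
  mps_pcomp K a = \prod_(j < m) mps_pcomp P [tuple of rcons a (tnth r j)].
Proof.
move=> hK ha hr hG.
set h : (n + m).-tuple (mps R p) := [tuple of a ++ r].
have hh : const_free h by rewrite /const_free /= all_cat; apply/andP.
have hx : const_free [tuple mpsX (lshift m i) : mps R (n + m) | i < n].
  by apply/const_freeP => i; rewrite tnth_mktuple mpsX_const.
have xE i : mps_comp (mpsX (lshift m i) : mps R (n + m)) h = tnth a i.
  by rewrite mps_compX // tnth_lshift.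
have rE j : mps_comp (mpsX (rshift n j) : mps R (n + m)) h = tnth r j.
  by rewrite mps_compX // tnth_rshift.
have xaE : [tuple mps_comp (tnth [tuple mpsX (lshift m i) | i < n] i) h | i < n] = a.
  by apply: eq_from_tnth => i; rewrite !tnth_mktuple xE.
set xr := fun j => [tuple of rcons
  [tuple mpsX (lshift m i) : mps R (n + m) | i < n] (mpsX (rshift n j))].
have hxr j : const_free (xr j).
  rewrite /const_free /= all_rcons; apply/andP; split; last exact: hx.
  by apply/eqP; apply: mpsX_const.
have xrE j : [tuple mps_comp (tnth (xr j) i) h | i < n.+1] = [tuple of rcons a (tnth r j)].
  apply: eq_from_tnth => i; rewrite tnth_mktuple !(tnth_nth 0) nth_rcons nth_rcons.
  rewrite !size_tuple; case: (ltngtP i n) (ltn_ord i) => [ilt _|ni|_ _].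
  - have -> : (i : nat) = Ordinal ilt by [].
    by rewrite -!tnth_nth tnth_mktuple xE.
  - by rewrite ltnS leqNgt ni.
  - by rewrite -tnth_nth rE.
have PE : \prod_(j < m) mps_pcomp (mps_pcomp P (xr j)) h
    = \prod_(j < m) mps_pcomp P [tuple of rcons a (tnth r j)].
  by apply: eq_bigr => j _; rewrite -xrE; apply: mps_pcomp_comp.
apply/polyP => k; have [c] := hK k => /(congr1 (mps_subst hh)).
have Sprod (Q : 'I_m -> {poly (mps R (n + m))}) l :
    mps_subst hh ((\prod_(j < m) Q j)`_l) = (\prod_(j < m) mps_pcomp (Q j) h)`_l.
  by rewrite -(mps_pcomp_prod hh) mps_pcomp_coef.
rewrite coefB rmorphB rmorph_sum /= [X in _ = X]big1 => [|l _].
  move/eqP; rewrite subr_eq0 Sprod -[mps_subst _ _]mps_pcomp_coef mps_pcomp_comp // xaE => /eqP->.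
  exact: (congr1 (fun q : {poly (mps R p)} => q`_k) PE).
rewrite /= rmorphM coefB rmorphB /= Sprod -[mps_subst _ _`_l]mps_pcomp_coef mps_pcomp_comp // xaE hG.
suff -> : \prod_(j < m) mps_pcomp (1 + (mpsX (rshift n j) : mps R (n + m)) *: 'X) h
    = \prod_(j < m) (1 + tnth r j *: 'X) by rewrite subrr mulr0.
by apply: eq_bigr => j _; rewrite mps_pcomp_lin // rE.
Qed.

End Substitution.

(** * Inverses, restriction to coordinate subspaces, square roots *)

Section Inverse.
Context {R : comNzRingType}.

Lemma mps_comp_coef n p (f : mps R n) (g : n.-tuple (mps R p)) m :
  mps_comp f g m =
  \sum_(k : 'X_{1..n < (mdeg m).+1}) f k * (\prod_(i < n) tnth g i ^+ k i) m.
Proof. by []. Qed.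

(** Factoring out [a - b] leaves a sum of products of [k.+1] series without constant term, and one
    such factor already raises the order by 1. *)
Lemma ord_ge_subX n k d (a b : mps R n) : a 0%MM = 0 -> b 0%MM = 0 ->
  ord_ge d (a - b) -> ord_ge d.+1 (a ^+ k.+2 - b ^+ k.+2).
Proof.
move=> a0 b0 hab; rewrite subrXX -addn1; apply: ord_geM => //.
apply: ord_ge_sum => i _; apply: ord_ge1.
rewrite mps_coef0M; have [/eqP|ik] := posnP (k.+2.-1 - i)%N.
  rewrite subn_eq0 => ki; have i0 : (0 < i)%N by apply: leq_trans ki.
  by rewrite -(prednK i0) exprS mps_coef0M b0 mul0r mulr0.
by rewrite -(prednK ik) exprS mps_coef0M a0 !mul0r.
Qed.

(** With [f = c x + h] and [h] of order at least 2, the inverse solves [g = u (x - h(g))], a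
    contraction. *)
Lemma mps_right_inverse (f : mps R 1) (u : R) :
  f 0%MM = 0 -> u * f U_(ord0)%MM = 1 ->
  exists g : mps R 1, [/\ g 0%MM = 0, f U_(ord0)%MM * g U_(ord0)%MM = 1
    & mps_comp f [tuple g] = var 1 0].
Proof.
move=> f0 uf; pose X : mps R 1 := var 1 0; pose c := f U_(ord0)%MM.
have X0 : X 0%MM = 0 by apply: mpsX_const.
(* [cf] removes the constant term, so that [Phi] contracts on all series; the fixed point has no
   constant term and is left unchanged. *)
pose h := f - mpsC c * X; pose cf (g : mps R 1) := g - mpsC (g 0%MM).
have cf0 g : cf g 0%MM = 0 by rewrite mps_coefB /= eqxx subrr.
have h2 : ord_ge 2 h.
  move=> m; rewrite ltnS leq_eqVlt ltnS leqn0 => /orP[/mdeg1P[i /eqP->]|].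
    rewrite (ord1 i) mps_coefB mps_coefCM mpsX_lin.
    by rewrite (_ : _ == _) ?mulr1 ?subrr.
  by rewrite mdeg_eq0 => /eqP->; rewrite mps_coefB mps_coefCM X0 f0 mulr0 subrr.
pose Phi g := mpsC u * (X - mps_comp h [tuple cf g]).
have [|g gE] := @mps_fixpoint R 1 Phi.
  move=> d a b hab.
  have hcf : ord_ge d (cf a - cf b).
    have -> : cf a - cf b = a - b - mpsC ((a - b) 0%MM).
      by rewrite /cf mps_coefB rmorphB /=; ring.
    move=> m hm; rewrite mps_coefB hab // [(a - b) _]hab ?mdeg0 ?(leq_ltn_trans _ hm) //.
    by rewrite rmorph0 mps_coef0 subrr.
  have -> : Phi a - Phi b
      = - (mpsC u * (mps_comp h [tuple cf a] - mps_comp h [tuple cf b])).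
    by rewrite /Phi; ring.
  apply: ord_geN; rewrite -[d.+1]add0n; apply: ord_geM; first exact: ord_ge0.
  move=> m hm; rewrite mps_coefB !mps_comp_coef -sumrB big1 // => k _; rewrite -mulrBr.
  rewrite !big_ord1 !(tnth_nth 0) -mps_coefB; case: (ltnP (mdeg k) 2) => [/h2->|]; first by rewrite mul0r.
  rewrite mdegE big_ord1 => k2; rewrite -(subnK k2) addn2.
  by rewrite [X in _ * X](ord_ge_subX _ (cf0 a) (cf0 b) hcf) ?mulr0.
have g0 : g 0%MM = 0.
  by rewrite -gE mps_coefCM mps_coefB X0 mps_comp_const h2 ?mdeg0 // subr0 mulr0.
have cfg : cf g = g by rewrite /cf g0 rmorph0 subr0.
have fg : mps_comp f [tuple g] = X.
  have hg : const_free [tuple g] by apply: const_free1.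
  have E : mps_comp f [tuple g] = mps_comp h [tuple g] + mpsC c * g.
    rewrite mps_compB mps_compM // mps_compC mps_compX // (tnth_nth 0) /=.
    by rewrite subrK.
  have gE' : g = mpsC u * (X - mps_comp h [tuple g]) by rewrite -[LHS]gE /Phi cfg.
  rewrite E [X in _ * X]gE' mulrA -rmorphM [c * u]mulrC uf rmorph1 mul1r.
  by rewrite addrC subrK.
exists g; split=> //.
have hg : const_free [tuple g] by apply: const_free1.
have := congr1 (fun a : mps R 1 => a U_(ord0)%MM) fg.
rewrite mps_comp_lin // big_ord1 (tnth_nth 0) => ->; rewrite mpsX_lin (_ : _ == _) //.
Qed.

(** A right inverse [g] of [f] has in turn a right inverse [h], and associativity of composition
    gives [f = h], so [g] is two-sided. Hence [xget] picks a genuine inverse. *)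
Lemma comp_inverseP (f : mps R 1) (u : R) :
  f 0%MM = 0 -> u * f U_(ord0)%MM = 1 ->
  let g := comp_inverse f in
  [/\ g 0%MM = 0, mps_comp f [tuple g] = var 1 0 & mps_comp g [tuple f] = var 1 0].
Proof.
move=> f0 uf; apply: (@classical_sets.xgetPex _ 0 (fun g : mps R 1 => [/\ g 0%MM = 0,
  mps_comp f [tuple g] = var 1 0 & mps_comp g [tuple f] = var 1 0])).
have [g [g0 gu fg]] := mps_right_inverse f0 uf; exists g; split=> //.
have [h [h0 _ gh]] := mps_right_inverse g0 gu.
suff -> : f = h by [].
rewrite -[LHS]mps_comp_var1 -gh.
rewrite -mps_comp_comp1 ?fg ?mps_compX ?(tnth_nth 0) //; exact: const_free1.
Qed.

End Inverse.

Section Restriction.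
Context {R : comNzRingType} {n : nat}.
Implicit Types (f g : mps R n) (m : 'X_{1..n}).

Lemma mps_restrict_coef (T : pred 'I_n) f m : (forall i, ~~ T i -> m i = 0%N) ->
  mps_comp f [tuple (if T i then mpsX i else 0) | i < n] m = f m.
Proof.
move=> hm; rewrite /= (bigD1 (BMultinom (ltnSn (mdeg m)))) //=.
have prodE (k : 'X_{1..n}) : (forall i, ~~ T i -> k i = 0%N) ->
    \prod_(i < n) tnth [tuple (if T i then mpsX i : mps R n else 0) | i < n] i ^+ k i
    = mps_of_mpoly 'X_[k].
  move=> hk; rewrite mpolyXE_id rmorph_prod; apply: eq_bigr => i _.
  rewrite tnth_mktuple rmorphXn /= -mpsX_mpoly; case: ifPn => // /hk ->.
  by rewrite !expr0.
rewrite prodE //= mcoeffX eqxx mulr1 big1 ?addr0 // => k km.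
have [/forallP hk|] := boolP [forall i, ~~ T i ==> (k i == 0%N)].
  rewrite prodE => [|i /(implyP (hk i))/eqP //]; rewrite /= mcoeffX.
  by case: eqP => [kE|]; [case/eqP: km; apply: val_inj | rewrite mulr0].
rewrite negb_forall => /existsP[i]; rewrite negb_imply => /andP[Ti ki].
have z : tnth [tuple (if T i then mpsX i : mps R n else 0) | i < n] i ^+ k i = 0.
  by rewrite tnth_mktuple (negbTE Ti) expr0n (negbTE ki).
suff -> : \prod_(i < n) tnth [tuple (if T i then mpsX i : mps R n else 0) | i < n] i ^+ k i = 0.
  by rewrite mps_coef0 mulr0.
by rewrite (bigD1 i) //= z mul0r.
Qed.

(** Restriction to the hyperplane where the [i]-th variable is 0, still written in [n] variables. *)
Definition mps_kill (i : 'I_n) f := 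
  mps_comp f [tuple (if j != i then mpsX j else 0) | j < n].

Lemma mps_kill_coef i f m : m i = 0%N -> mps_kill i f m = f m.
Proof. by move=> mi; apply: mps_restrict_coef => j; rewrite negbK => /eqP->. Qed.

Lemma const_free_kill i :
  const_free [tuple (if j != i then mpsX j else 0) : mps R n | j < n].
Proof.
by apply/const_freeP => j; rewrite tnth_mktuple; case: ifP; rewrite ?mpsX_const ?mps_coef0.
Qed.

Lemma mps_kill_eq0 i f : mps_kill i f = 0 -> f = mpsX i * mps_shift i f.
Proof.
by move=> kf; apply: mps_shiftE => m mi; rewrite -(mps_kill_coef f mi) kf mps_coef0.
Qed.

(* Dividing out the variable from a multiple killed by [f] again gives one. *)
Lemma mps_lreg_kill i f : GRing.lreg (mps_kill i f) -> GRing.lreg f.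
Proof.
move=> hf; suff H d g : f * g = 0 -> forall m, m i = d -> g m = 0.
  by apply: lreg_of_mul0 => g fg; apply: mpsP => m; rewrite mps_coef0 (H (m i) g).
elim: d g => [|d IH] g fg m mi.
  rewrite -(mps_kill_coef g mi) -[g]mul1r; have -> : mps_kill i (1 * g) = 0.
    apply: (lreg_mul0 hf); rewrite mul1r -mps_compM ?const_free_kill // fg.
    exact: (rmorph0 (mps_subst (const_free_kill i))).
  exact: mps_coef0.
have gE : g = mpsX i * mps_shift i g.
  apply: mps_kill_eq0; apply: (lreg_mul0 hf).
  rewrite -mps_compM ?const_free_kill // fg.
  exact: (rmorph0 (mps_subst (const_free_kill i))).
have mE : (m - U_(i) + U_(i) = m)%MM.
  by rewrite submK //; apply/mnm_lepP => j; rewrite mnm1E; case: eqP => [<-|]; rewrite ?mi.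
rewrite gE -mE mps_coefXM; apply: IH.
  by apply: (@mpsX_lreg R n i); rewrite mulrCA -gE fg mulr0.
by rewrite mnmBE mi mnm1E eqxx subn1.
Qed.

End Restriction.

Section Diagonal.
Context {R : comNzRingType}.

Lemma mps_perm_coef n (s : 'S_n) (f : mps R n) (m : 'X_{1..n}) :
  mps_comp f [tuple mpsX (s i) | i < n] m = f [multinom m (s i) | i < n].
Proof.
have prodE (k : 'X_{1..n}) :
    \prod_(i < n) tnth [tuple mpsX (s i) : mps R n | i < n] i ^+ k i
    = mps_of_mpoly 'X_[[multinom k (s^-1 i)%g | i < n]].
  rewrite mpolyXE_id rmorph_prod (reindex_inj (@perm_inj _ s^-1%g)) /=.
  apply: eq_bigr => i _; rewrite tnth_mktuple permKV mnmE rmorphXn mpsX_mpoly //.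
have lt_m : (mdeg [multinom m (s i) | i < n] < (mdeg m).+1)%N.
  rewrite ltnS !mdegE (reindex_inj (@perm_inj _ s^-1%g)) /=.
  by rewrite leq_eqVlt; apply/orP; left; apply/eqP/eq_bigr => i _; rewrite mnmE permKV.
rewrite mps_comp_coef (bigD1 (BMultinom lt_m)) //= [X in _ + X]big1 => [|k km].
  rewrite prodE /= mcoeffX (_ : _ == _) ?mulr1 ?addr0 //.
  by apply/eqP/mnmP => i; rewrite !mnmE permKV.
rewrite prodE /= mcoeffX; case: eqP => [kE|]; last by rewrite mulr0.
case/eqP: km; apply/val_inj => /=; apply/mnmP => i.
by have /mnmP/(_ (s i)) := kE; rewrite !mnmE permK.
Qed.

Definition mnm2 a b : 'X_{1..2} := [multinom [tuple a; b]].
Definition mnm3 a b c : 'X_{1..3} := [multinom [tuple a; b; c]].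

Lemma mnm3E (m : 'X_{1..3}) :
  m = mnm3 (m (@Ordinal 3 0 isT)) (m (@Ordinal 3 1 isT)) (m (@Ordinal 3 2 isT)).
Proof.
apply/mnmP => i; rewrite [RHS](mnm_nth 0%N); case: i => [[|[|[|]]]] // h /=;
  by congr (m _); apply: val_inj.
Qed.

Lemma mnm2E (m : 'X_{1..2}) : m = mnm2 (m (@Ordinal 2 0 isT)) (m (@Ordinal 2 1 isT)).
Proof.
apply/mnmP => i; rewrite [RHS](mnm_nth 0%N); case: i => [[|[|]]] // h /=;
  by congr (m _); apply: val_inj.
Qed.

(** The monomials that become [x^a y^b] on the diagonal are those whose first two exponents add up
    to [a] and whose third is [b]. *)
Lemma mps_diag_coef (f : mps R 3) a b :
  mps_comp f [tuple var 2 0; var 2 0; var 2 1] (mnm2 a b)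
  = \sum_(i < a.+1) f (mnm3 i (a - i) b).
Proof.
pose k0 := @Ordinal 3 0 isT; pose k1 := @Ordinal 3 1 isT; pose k2 := @Ordinal 3 2 isT.
have prodE (k : 'X_{1..3}) :
    \prod_(i < 3) tnth [tuple (var 2 0 : mps R 2); var 2 0; var 2 1] i ^+ k i
    = mps_of_mpoly 'X_[mnm2 (k k0 + k k1) (k k2)].
  have -> : mnm2 (k k0 + k k1) (k k2)
      = (U_(@Ordinal 2 0 isT) *+ (k k0 + k k1) + U_(@Ordinal 2 1 isT) *+ k k2)%MM.
    by apply/mnmP => i; rewrite mnmDE !mulmnE !mnm1E (mnm_nth 0%N); case: i => [[|[|]]] // h;
      rewrite /= ?muln1 ?muln0 ?mul1n ?mul0n ?addn0.
  rewrite mpolyXD -!mpolyXn rmorphM !rmorphXn /= -!mpsX_mpoly exprD.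
  rewrite !big_ord_recl big_ord0 mulr1 mulrA.
  rewrite (_ : ord0 = k0); last exact: val_inj.
  rewrite (_ : lift k0 ord0 = k1); last exact: val_inj.
  rewrite (_ : lift k0 (lift ord0 ord0) = k2); last exact: val_inj.
  by rewrite !(tnth_nth 0).
have lt_m (i : 'I_a.+1) : (mdeg (mnm3 i (a - i) b) < (mdeg (mnm2 a b)).+1)%N.
  rewrite !mdegE !big_ord_recl !big_ord0 !(mnm_nth 0%N) /=.
  by have := ltn_ord i; lia.
pose h (i : 'I_a.+1) := BMultinom (lt_m i).
rewrite mps_comp_coef; under eq_bigr => k _ do rewrite prodE /= mcoeffX.
rewrite (bigID (fun k : 'X_{1..3 < _} => mnm2 (k k0 + k k1) (k k2) == mnm2 a b)) /=.
rewrite [X in _ + X]big1 ?addr0 => [|k /negbTE->]; last by rewrite mulr0.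
rewrite (reindex_onto h (fun k : 'X_{1..3 < _} => inord (k k0))) /=; last first.
  move=> k /eqP kE; apply: val_inj => /=; rewrite [RHS]mnm3E.
  have /mnmP/(_ (@Ordinal 2 0 isT)) := kE; have /mnmP/(_ (@Ordinal 2 1 isT)) := kE.
  rewrite ![mnm2 _ _ _](mnm_nth 0%N) /= => k2E k01E.
  have lt_k0 : (k k0 < a.+1)%N.
    by rewrite ltnS (leq_trans (leq_addr (k k1) _)) // leq_eqVlt k01E eqxx.
  rewrite inordK //; congr mnm3; last exact: esym k2E.
  by apply: (@addnI (k k0)); rewrite subnKC.
apply: eq_big => [i|i _].
  rewrite ![mnm3 _ _ _ _](mnm_nth 0%N) /= subnKC -1?ltnS // eqxx /=.
  by rewrite inord_val eqxx.
by rewrite ![mnm3 _ _ _ _](mnm_nth 0%N) /= subnKC -1?ltnS // eqxx mulr1.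
Qed.

(** The coordinate change [x |-> x + y] turns the diagonal [x = y] into the hyperplane [x = 0],
    where [mps_lreg_kill] applies; [x |-> x - y] undoes it. *)
Lemma mps_lreg_diag (f : mps R 3) :
  GRing.lreg (mps_comp f [tuple var 3 1; var 3 1; var 3 2]) -> GRing.lreg f.
Proof.
move=> hf; pose x : mps R 3 := var 3 0; pose y : mps R 3 := var 3 1.
pose z : mps R 3 := var 3 2.
have [x0 y0 z0] : [/\ x 0%MM = 0, y 0%MM = 0 & z 0%MM = 0] by split; apply: mpsX_const.
have hp : const_free [tuple x + y; y; z].
  by apply: const_free3; rewrite ?mps_coefD ?x0 ?y0 ?addr0.
have hm : const_free [tuple x - y; y; z].
  by apply: const_free3; rewrite ?mps_coefB ?x0 ?y0 ?subr0.
have hF : GRing.lreg (mps_comp f [tuple x + y; y; z]).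
  apply: (@mps_lreg_kill _ _ (@Ordinal 3 0 isT)).
  have hk := @const_free_kill R 3 (@Ordinal 3 0 isT).
  rewrite /mps_kill mps_comp_comp3 ?mps_coefD ?x0 ?y0 ?addr0 //.
  rewrite -[mps_comp (x + y) _]/(mps_subst hk _) rmorphD /= /mps_subst.
  by rewrite !mps_compX // !tnth_mktuple /= add0r.
apply: lreg_of_mul0 => g fg.
have gE : g = mps_comp (mps_comp g [tuple x + y; y; z]) [tuple x - y; y; z].
  rewrite mps_comp_comp3 ?mps_coefD ?x0 ?y0 ?addr0 //.
  rewrite -[mps_comp (x + y) _]/(mps_subst hm _) rmorphD /= /mps_subst.
  rewrite !mps_compX // !(tnth_nth 0) /= subrK.
  by rewrite mps_comp_var3.
have g0 : mps_comp g [tuple x + y; y; z] = 0.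
  by apply: (lreg_mul0 hF); rewrite -mps_compM // fg; apply: (rmorph0 (mps_subst hp)).
by rewrite gE g0; apply: (rmorph0 (mps_subst hm)).
Qed.

End Diagonal.

(** For a root of the form [c + g] the equation reads [2 c g = E - c^2 - g^2]. This is a contraction
    on series without constant term, and [v] inverts [2 c]. *)
Lemma mps_sqrt (R : comNzRingType) n (E : mps R n) (c v : R) :
  E 0%MM = c ^+ 2 -> v * (2%:R * c) = 1 ->
  exists2 V : mps R n, V ^+ 2 = E & V 0%MM = c.
Proof.
move=> E0 vc; pose cf (g : mps R n) := g - mpsC (g 0%MM).
have cf0 g : cf g 0%MM = 0 by rewrite mps_coefB /= eqxx subrr.
pose Phi g := mpsC v * (E - mpsC (c ^+ 2) - cf g ^+ 2).
have [|g gE] := @mps_fixpoint R n Phi.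
  move=> d a b hab.
  have -> : Phi a - Phi b = - (mpsC v * ((cf a - cf b) * (cf a + cf b))).
    by rewrite /Phi; ring.
  apply: ord_geN; rewrite -[d.+1]add0n; apply: ord_geM; first exact: ord_ge0.
  rewrite -addn1; apply: ord_geM; last first.
    by apply: ord_ge1; rewrite mps_coefD !cf0 addr0.
  have -> : cf a - cf b = a - b - mpsC ((a - b) 0%MM).
    by rewrite /cf mps_coefB rmorphB /=; ring.
  move=> m hm; rewrite mps_coefB hab // [(a - b) _]hab ?mdeg0 ?(leq_ltn_trans _ hm) //.
  by rewrite rmorph0 mps_coef0 subrr.
have g0 : g 0%MM = 0.
  rewrite -gE mps_coefCM !mps_coefB E0 expr2 mps_coef0M cf0 mulr0.
  by rewrite [mpsC _ _]/= eqxx !subr0 -expr2 subrr mulr0.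
have cfg : cf g = g by rewrite /cf g0 rmorph0 subr0.
exists (mpsC c + g); last by rewrite mps_coefD g0 /= eqxx addr0.
have h : mpsC (2%:R * c) * g = E - mpsC (c ^+ 2) - g ^+ 2.
  by rewrite -{1}gE mulrA -rmorphM mulrC [_ * v]mulrC vc rmorph1 mulr1 cfg.
by rewrite sqrrD -rmorphXn /= -mulr_natl mulrA -(rmorph_nat (@mpsC R n)) -rmorphM h; ring.
Qed.

(** * Formal ternary laws *)

Section TernaryLaw.
Context {R : comUnitRingType} {A : grading R}.
Context (two_unit : (2%:R : R) \is a GRing.unit).
Context {iota Psi : mps R 1} {F : {poly (mps R 3)}}.
Context (FTL : formal_ternary_law A iota Psi F).

Local Notation F3 a b c := (mps_pcomp F [tuple a; b; c]).
Local Notation io a := (mps_comp iota [tuple a]).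
Local Notation lin a := (1 + a *: 'X).

Lemma two_natC n : (2%:R : mps R n) = mpsC 2%:R.
Proof. by rewrite rmorph_nat. Qed.

Lemma two_lreg n : GRing.lreg (2%:R : mps R n).
Proof.
apply: lreg_of_mul0 => b b2; rewrite -[b]mul1r -(rmorph1 (@mpsC R n)).
by rewrite -(mulVr two_unit) rmorphM -mulrA /= -two_natC b2 mulr0.
Qed.

Lemma unit_lreg (u : R) : u \is a GRing.unit -> GRing.lreg u.
Proof. by move=> hu a b; apply: mulrI. Qed.

Lemma mps_comp1_0 p (f : mps R 1) : f 0%MM = 0 -> mps_comp f [tuple (0 : mps R p)] = 0.
Proof.
move=> f0; have h0 : const_free [tuple (0 : mps R p)].
  by apply: const_free1; apply: mps_coef0.
have -> : f = var 1 0 * mps_shift (@Ordinal 1 0 isT) f.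
  apply: mps_shiftE => m m0; suff -> : m = 0%MM by [].
  apply/mnmP => i; rewrite mnm0E (ord1 i) -[RHS]m0.
  by congr (m _); apply: val_inj.
by rewrite mps_compM // mps_compX // (tnth_nth 0) mul0r.
Qed.

Let frame := ftl_framed FTL.

Lemma iota_const : iota 0%MM = 0.
Proof.
rewrite (framed_iota frame) mps_coefB two_natC mps_coefCM (framed_const frame).
by rewrite mpsX_const mulr0 subr0.
Qed.

Lemma iota_lin : iota U_(ord0)%MM = -1.
Proof.
rewrite (framed_iota frame) mps_coefB two_natC mps_coefCM (framed_lin frame).
by rewrite mpsX_lin (_ : _ == _) // mulr1n mulr1; ring.
Qed.

(** * The axioms evaluated at points *)

Section Points.
Context {p : nat}.
Implicit Types a b c d e : mps R p.

Lemma io_const a : io a 0%MM = 0.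
Proof. by rewrite mps_comp_const iota_const. Qed.

Lemma ioK a : a 0%MM = 0 -> io (io a) = a.
Proof.
move=> a0; have ha := const_free1 a0.
rewrite -mps_comp_comp1 ?iota_const // (framed_invol frame).
by rewrite mps_compX // (tnth_nth 0).
Qed.

Lemma io0 : io (0 : mps R p) = 0. Proof. exact: mps_comp1_0 iota_const. Qed.

Lemma io_lin a j : a 0%MM = 0 -> io a U_(j)%MM = - a U_(j)%MM.
Proof.
move=> a0; rewrite mps_comp_lin ?const_free1 // big_ord1 (tnth_nth 0) iota_lin.
by rewrite mulN1r.
Qed.

Lemma io_Psi a : a 0%MM = 0 -> io a = a - 2%:R * mps_comp Psi [tuple a].
Proof.
move=> a0; have ha := const_free1 a0; rewrite {1}(framed_iota frame) mps_compB.
by rewrite mps_compM // mps_compX // two_natC mps_compC -two_natC (tnth_nth 0).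
Qed.

Lemma ftl_coef0 a b c : (F3 a b c)`_0 = 1.
Proof.
have [F0 _ _] := ftl_series FTL.
by rewrite mps_pcomp_coef F0 -(rmorph1 (@mpsC R 3)) mps_compC rmorph1.
Qed.

Lemma ftl_size a b c : (size (F3 a b c) <= 5)%N.
Proof. by have [_ sF _] := ftl_series FTL; apply: mps_pcomp_size. Qed.

Lemma ftl_point_unit a : a 0%MM = 0 -> F3 a 0 0 = lin a ^+ 2 * lin (io a) ^+ 2.
Proof.
move=> a0; have ha := const_free1 a0.
have := congr1 (fun G => mps_pcomp G [tuple a]) (ftl_unit FTL).
rewrite mps_pcomp_comp3 ?mpsX_const ?mps_coef0 // mps_compX // (tnth_nth 0).
have -> : mps_comp (0 : mps R 1) [tuple a] = 0 := rmorph0 (mps_subst ha); move=> ->.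
by rewrite mps_pcompM // !mps_pcompXn // !mps_pcomp_lin // mps_compX // (tnth_nth 0).
Qed.

Lemma ftl_point_perm (g : 3.-tuple (mps R p)) (s : 'S_3) : const_free g ->
  mps_pcomp F [tuple tnth g (s i) | i < 3] = mps_pcomp F g.
Proof.
move=> hg; rewrite -[in RHS](ftl_sym FTL s) mps_pcomp_comp //; last first.
  by apply/const_freeP => i; rewrite tnth_mktuple mpsX_const.
by congr mps_pcomp; apply: eq_from_tnth => i; rewrite !tnth_mktuple mps_compX.
Qed.

Lemma ftl_swap12 a b c : a 0%MM = 0 -> b 0%MM = 0 -> c 0%MM = 0 -> F3 a b c = F3 b a c.
Proof.
move=> a0 b0 c0; rewrite -(@ftl_point_perm _ (tperm ord0 (Ordinal (isT : 1 < 3)%N))).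
  congr mps_pcomp; apply: eq_from_tnth => i; rewrite tnth_mktuple.
  by rewrite permE; case: i => [[|[|[|]]]].
exact: const_free3.
Qed.

Lemma ftl_swap23 a b c : a 0%MM = 0 -> b 0%MM = 0 -> c 0%MM = 0 -> F3 a b c = F3 a c b.
Proof.
move=> a0 b0 c0.
rewrite -(@ftl_point_perm _ (tperm (Ordinal (isT : 1 < 3)%N) (Ordinal (isT : 2 < 3)%N))).
  congr mps_pcomp; apply: eq_from_tnth => i; rewrite tnth_mktuple.
  by rewrite permE; case: i => [[|[|[|]]]].
exact: const_free3.
Qed.

(** The coefficients of [t] and [t^2] determine the series [S] and [P] provided by the diagonal
    axiom, so these are [ftl_S F] and [ftl_P F]. *)
Lemma ftl_point_diag a b : a 0%MM = 0 -> b 0%MM = 0 ->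
  F3 a a b = lin b ^+ 2 * (1 + mps_comp (ftl_S F) [tuple a; b] *: 'X
                             + mps_comp (ftl_P F) [tuple a; b] *: 'X^2).
Proof.
move=> a0 b0; have hab := const_free2 a0 b0; have [S [P E]] := ftl_diag FTL.
have E1 := congr1 (fun G : {poly mps R 2} => G`_1) E.
have E2 := congr1 (fun G : {poly mps R 2} => G`_2) E.
have Ex : (lin (var 2 1 : mps R 2)) ^+ 2 * (1 + S *: 'X + P *: 'X^2)
   = 1 + (S + 2%:R * var 2 1) *: 'X
     + (P + 2%:R * var 2 1 * S + var 2 1 ^+ 2) *: 'X^2
     + (2%:R * var 2 1 * P + var 2 1 ^+ 2 * S) *: 'X^3 + (var 2 1 ^+ 2 * P) *: 'X^4.
  by rewrite -!mul_polyC !(rmorphD, rmorphM, rmorphXn, rmorph_nat) /=; ring.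
have SE : ftl_S F = S.
  rewrite /ftl_S -mps_pcomp_coef E1 Ex !coefD !coefZ !coefXn coefX coef1 /=.
  by rewrite !mulr0 mulr1 add0r !addr0 addrK.
have PE : ftl_P F = P.
  rewrite /ftl_P SE -mps_pcomp_coef E2 Ex !coefD !coefZ !coefXn coefX coef1 /=.
  by ring.
have := congr1 (fun G => mps_pcomp G [tuple a; b]) E; rewrite SE PE.
rewrite mps_pcomp_comp3 ?mpsX_const // !mps_compX // !(tnth_nth 0) /= => ->.
rewrite mps_pcompM // mps_pcompXn // mps_pcomp_lin // mps_compX // (tnth_nth 0).
congr (_ * _); rewrite (mps_pcomp_subst hab) !rmorphD rmorph1 /= !map_polyZ.
by rewrite map_polyX map_polyXn.
Qed.

Definition lin4 a b c d := lin a * lin b * lin c * lin d.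

Lemma lin4_tuple a b c d :
  lin4 a b c d = \prod_(j < 4) (1 + tnth [tuple a; b; c; d] j *: 'X).
Proof. by rewrite !big_ord_recl big_ord0 !(tnth_nth 0) /= mulr1 /lin4 !mulrA. Qed.

(** When both inner values of [F] split at the point, [rootwise_split] computes the series [K] of
    the associativity axiom in two ways. *)
Lemma ftl_point_assoc a b c d e r1 r2 r3 r4 s1 s2 s3 s4 :
  const_free [tuple a; b; c; d; e] ->
  const_free [tuple r1; r2; r3; r4] -> const_free [tuple s1; s2; s3; s4] ->
  F3 a b c = lin4 r1 r2 r3 r4 -> F3 b c d = lin4 s1 s2 s3 s4 ->
  F3 r1 d e * F3 r2 d e * F3 r3 d e * F3 r4 d e
  = F3 a s1 e * F3 a s2 e * F3 a s3 e * F3 a s4 e.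
Proof.
move=> hx hr hs E1 E2; have [K [K1 K2]] := ftl_assoc FTL.
have [a0 b0 c0 d0 e0] : [/\ a 0%MM = 0, b 0%MM = 0, c 0%MM = 0, d 0%MM = 0 & e 0%MM = 0].
  by move: hx; rewrite /const_free /= => /and5P[/eqP-> /eqP-> /eqP-> /eqP-> /andP[/eqP->]].
have hxr (r : mps R p) : r 0%MM = 0 -> const_free [tuple of rcons [tuple a; b; c; d; e] r].
  by move=> r0; rewrite /const_free /= a0 b0 c0 d0 e0 r0 !eqxx.
have K1E : mps_pcomp K [tuple a; b; c; d; e]
    = \prod_(j < 4) F3 (tnth [tuple r1; r2; r3; r4] j) d e.
  rewrite (rootwise_split K1 hx hr).
    apply: eq_bigr => j _; have r0 := const_freeP _ hr j; move: (tnth _ j) r0 => r r0.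
    by rewrite mps_pcomp_comp3 ?mpsX_const ?hxr // !mps_compX ?hxr //.
  by rewrite mps_pcomp_comp3 ?mpsX_const // !mps_compX // !(tnth_nth 0) -lin4_tuple.
have K2E : mps_pcomp K [tuple a; b; c; d; e]
    = \prod_(j < 4) F3 a (tnth [tuple s1; s2; s3; s4] j) e.
  rewrite (rootwise_split K2 hx hs).
    apply: eq_bigr => j _; have r0 := const_freeP _ hs j; move: (tnth _ j) r0 => r r0.
    by rewrite mps_pcomp_comp3 ?mpsX_const ?hxr // !mps_compX ?hxr //.
  by rewrite mps_pcomp_comp3 ?mpsX_const // !mps_compX // !(tnth_nth 0) -lin4_tuple.
have := K1E; rewrite K2E.
by rewrite !big_ord_recl !big_ord0 !(tnth_nth 0) /= !mulr1 !mulrA => ->.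
Qed.

End Points.

Lemma lin_coef0 (S : comNzRingType) (a : S) : (1 + a *: 'X : {poly S})`_0 = 1.
Proof. by rewrite coefD coef1 coefZ coefX mulr0 addr0. Qed.

Lemma poly_cancel (S : comNzRingType) (P Q1 Q2 : {poly S}) :
  P`_0 = 1 -> P * Q1 = P * Q2 -> Q1 = Q2.
Proof. by move=> P0; apply: lreg_poly_coef0; rewrite P0; apply: lreg1. Qed.

(** * Compatibility of [F] with the involution *)

Section Involution.
Context {p : nat}.
Implicit Types a b c d e : mps R p.

(** Associativity at [(a, 0, 0, b, c)], where the inner roots are [a, a, io a, io a] and
    [b, b, io b, io b]. Both sides are squares sharing the factor [F3 a b c ^+ 2]. *)
Lemma ftl_io12 a b c : a 0%MM = 0 -> b 0%MM = 0 -> c 0%MM = 0 ->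
  F3 (io a) b c = F3 a (io b) c.
Proof.
move=> a0 b0 c0; have z0 : (0 : mps R p) 0%MM = 0 := mps_coef0 _.
have E1 : F3 a 0 0 = lin4 a a (io a) (io a).
  by rewrite ftl_point_unit // /lin4 !expr2 !mulrA.
have E2 : F3 0 0 b = lin4 b b (io b) (io b).
  by rewrite ftl_swap23 // ftl_swap12 // ftl_point_unit // /lin4 !expr2 !mulrA.
have h := ftl_point_assoc (const_free5 a0 z0 z0 b0 c0)
  (const_free4 a0 a0 (io_const a) (io_const a))
  (const_free4 b0 b0 (io_const b) (io_const b)) E1 E2.
apply: (@poly_cancel _ (F3 a b c)); first exact: ftl_coef0.
apply: sqr_poly_inj; rewrite ?coef0M ?ftl_coef0 ?mulr1 //; first exact: two_lreg.
by rewrite !exprMn !expr2 !mulrA h.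
Qed.

Lemma ftl_io23 a b c : a 0%MM = 0 -> b 0%MM = 0 -> c 0%MM = 0 ->
  F3 a (io b) c = F3 a b (io c).
Proof.
move=> a0 b0 c0; rewrite ftl_swap12 ?io_const // ftl_swap23 ?io_const //.
rewrite ftl_io12 // [RHS]ftl_swap12 ?io_const // [RHS]ftl_swap23 ?io_const //.
Qed.

(** [F3 (io a) (io a) b = F3 a (io (io a)) b = F3 a a b], and the quadratic factor is determined
    after cancelling [lin b ^+ 2]. *)
Lemma ftl_SP_io a b : a 0%MM = 0 -> b 0%MM = 0 ->
  mps_comp (ftl_S F) [tuple io a; b] = mps_comp (ftl_S F) [tuple a; b] /\
  mps_comp (ftl_P F) [tuple io a; b] = mps_comp (ftl_P F) [tuple a; b].
Proof.
move=> a0 b0; have : F3 (io a) (io a) b = F3 a a b.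
  by rewrite ftl_io12 ?io_const // ioK.
rewrite !ftl_point_diag ?io_const // => /poly_cancel.
rewrite expr2 coef0M lin_coef0 mulr1 => /(_ erefl) E.
have E1 := congr1 (fun G : {poly mps R p} => G`_1) E.
have E2 := congr1 (fun G : {poly mps R p} => G`_2) E.
by move: E1 E2; rewrite !coefD !coefZ !coefXn !coefX !coef1 /= !mulr0 !mulr1 !add0r !addr0.
Qed.

(** At [a = 0] the unit axiom leaves the perfect square [(1 + io b t)^2] as quadratic factor; this
    is why the discriminant vanishes there. *)
Lemma ftl_SP_0 b : b 0%MM = 0 ->
  mps_comp (ftl_S F) [tuple 0; b] = 2%:R * io b /\
  mps_comp (ftl_P F) [tuple 0; b] = io b ^+ 2.
Proof.
move=> b0; have z0 : (0 : mps R p) 0%MM = 0 := mps_coef0 _.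
have : F3 0 0 b = lin b ^+ 2 * (1 + (2%:R * io b) *: 'X + (io b ^+ 2) *: 'X^2).
  rewrite ftl_swap23 // ftl_swap12 // ftl_point_unit //; congr (_ * _).
  by rewrite -!mul_polyC !(rmorphM, rmorphXn, rmorph_nat) /=; ring.
rewrite !ftl_point_diag // => /poly_cancel.
rewrite expr2 coef0M lin_coef0 mulr1 => /(_ erefl) E.
have E1 := congr1 (fun G : {poly mps R p} => G`_1) E.
have E2 := congr1 (fun G : {poly mps R p} => G`_2) E.
by move: E1 E2; rewrite !coefD !coefZ !coefXn !coefX !coef1 /= !mulr0 !mulr1 !add0r !addr0.
Qed.

Lemma ftl_D_comp (g : 2.-tuple (mps R p)) : const_free g ->
  mps_comp (ftl_D F) g
  = mps_comp (ftl_S F) g ^+ 2 - 4%:R * mps_comp (ftl_P F) g.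
Proof.
move=> hg; rewrite -[LHS]/(mps_subst hg _) /ftl_D rmorphB rmorphXn rmorphM rmorph_nat.
by [].
Qed.

End Involution.

(** * The discriminant [D] and its square root *)

Section SquareRoot.

Let x : mps R 2 := var 2 0.
Let y : mps R 2 := var 2 1.
Let i0 := @Ordinal 2 0 isT.
Let i1 := @Ordinal 2 1 isT.

Lemma mps_coefXnM n (i : 'I_n) k (f : mps R n) :
  (mpsX i ^+ k * f) (U_(i) *+ k)%MM = f 0%MM.
Proof.
elim: k => [|k IH]; first by rewrite mul1r mulm0n.
by rewrite exprS -mulrA mulmS addmC mps_coefXM.
Qed.

Lemma ftl_coef_perm l (s : 'S_3) (m : 'X_{1..3}) : F`_l [multinom m (s i) | i < 3] = F`_l m.
Proof. by rewrite -mps_perm_coef -mps_pcomp_coef (ftl_sym FTL). Qed.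

Lemma ftl_coef_swap12 l a b c : F`_l (mnm3 a b c) = F`_l (mnm3 b a c).
Proof.
rewrite -(@ftl_coef_perm l (tperm ord0 (Ordinal (isT : 1 < 3)%N))).
congr (F`_l _); apply/mnmP => i; rewrite mnmE permE !(mnm_nth 0%N).
by case: i => [[|[|[|]]]].
Qed.

Lemma ftl_coef_swap23 l a b c : F`_l (mnm3 a b c) = F`_l (mnm3 a c b).
Proof.
rewrite -(@ftl_coef_perm l (tperm (Ordinal (isT : 1 < 3)%N) (Ordinal (isT : 2 < 3)%N))).
congr (F`_l _); apply/mnmP => i; rewrite mnmE permE !(mnm_nth 0%N).
by case: i => [[|[|[|]]]].
Qed.

(** With [iota(x) = x j] and [j(0) = -1], the leading coefficients of [(1 + x t)^2 (1 + x j t)^2]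
    are [2 + 2 j], [1 + 4 j + j^2] and [2 j + 2 j^2] evaluated at [j = -1]. *)
Lemma ftl_coef_axis : [/\ F`_1 (mnm3 1 0 0) = 0, F`_2 (mnm3 2 0 0) = - 2%:R
  & F`_3 (mnm3 3 0 0) = 0].
Proof.
pose X : mps R 3 := var 3 0; have X0 : X 0%MM = 0 by apply: mpsX_const.
pose j := mps_comp (mps_shift ord0 iota) [tuple X].
have j0 : j 0%MM = -1 by rewrite mps_comp_const /= add0m iota_lin.
have jE : io X = X * j.
  have hX := const_free1 X0.
  rewrite {1}[iota](@mps_shiftE _ _ ord0); last first.
    move=> m m0; rewrite (_ : m = 0%MM) ?iota_const //.
    by apply/mnmP => i; rewrite (ord1 i) m0 mnm0E.
  by rewrite mps_compM // mps_compX // (tnth_nth 0).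
have E : F3 X 0 0 = 1 + (X ^+ 1 * (2%:R + 2%:R * j)) *: 'X
    + (X ^+ 2 * (1 + 4%:R * j + j ^+ 2)) *: 'X^2
    + (X ^+ 3 * (2%:R * j + 2%:R * j ^+ 2)) *: 'X^3 + (X ^+ 4 * j ^+ 2) *: 'X^4.
  rewrite ftl_point_unit // jE.
  by rewrite -!mul_polyC !(rmorphM, rmorphD, rmorphXn, rmorph_nat, rmorph1) /=; ring.
have cE l k : F`_l (mnm3 k 0 0) = (F3 X 0 0)`_l (U_(@Ordinal 3 0 isT) *+ k)%MM.
  have -> : [tuple X; 0; 0] = [tuple (if i == @Ordinal 3 0 isT then mpsX i else 0) | i < 3].
    apply: eq_from_tnth => i; rewrite tnth_mktuple (tnth_nth 0).
    by case: i => [[|[|[|]]]] // h; rewrite /X; congr mpsX; apply: val_inj.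
  rewrite mps_pcomp_coef mps_restrict_coef.
    congr (F`_l _); apply/mnmP => i; rewrite mulmnE mnm1E (mnm_nth 0%N).
    by case: i => [[|[|[|]]]] // h; rewrite /= ?mul1n ?mul0n.
  by move=> i; rewrite mulmnE mnm1E eq_sym => /negbTE->.
have [E1 E2 E3] : [/\ (F3 X 0 0)`_1 = X ^+ 1 * (2%:R + 2%:R * j),
    (F3 X 0 0)`_2 = X ^+ 2 * (1 + 4%:R * j + j ^+ 2)
  & (F3 X 0 0)`_3 = X ^+ 3 * (2%:R * j + 2%:R * j ^+ 2)].
  rewrite E !coefD !coefZ !coefXn !coefX !coef1 /=.
  by rewrite !mulr0 !mulr1 !add0r !addr0.
have n0 k : (k%:R : mps R 3) 0%MM = k%:R.
  by rewrite -(rmorph_nat (@mpsC R 3)) /= eqxx.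
rewrite !cE E1 E2 E3 !mps_coefXnM !expr2 !(mps_coefD, mps_coef0M) !(n0, n0 1%N) j0.
by split; ring.
Qed.

(** Each factor [y] is put to the left of its cofactor, so that [mps2_coefXM0] and [mps2_coefXM]
    read off the coefficients. *)
Lemma ftl_diag_coefs :
  [/\ (F3 x x y)`_1 = ftl_S F + 2%:R * y,
      (F3 x x y)`_2 = ftl_P F + 2%:R * (y * ftl_S F) + y * y
    & (F3 x x y)`_3 = y * (2%:R * ftl_P F + y * ftl_S F)].
Proof.
have -> : F3 x x y = 1 + (ftl_S F + 2%:R * y) *: 'X
     + (ftl_P F + 2%:R * (y * ftl_S F) + y * y) *: 'X^2
     + (y * (2%:R * ftl_P F + y * ftl_S F)) *: 'X^3 + (y ^+ 2 * ftl_P F) *: 'X^4.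
  rewrite ftl_point_diag ?mpsX_const // !mps_comp_var2.
  by rewrite -!mul_polyC !(rmorphD, rmorphM, rmorphXn, rmorph_nat) /=; ring.
rewrite !coefD !coefZ !coefXn !coefX !coef1 /=.
by rewrite !mulr0 !mulr1 !add0r !addr0.
Qed.

Lemma mps2_coefXM0 (f : mps R 2) a : (y * f) (mnm2 a 0) = 0.
Proof. by apply: mps_coefXM0; rewrite (mnm_nth 0%N). Qed.

Lemma mps2_coefXM (f : mps R 2) a b : (y * f) (mnm2 a b.+1) = f (mnm2 a b).
Proof.
rewrite -(mps_coefXM i1 f); congr (_ _); apply/mnmP => i.
by rewrite mnmDE mnm1E !(mnm_nth 0%N); case: i => [[|[|]]] // h /=; rewrite ?addn0 ?addn1.
Qed.

Lemma two_inj (a : R) : 2%:R * a = 0 -> a = 0.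
Proof. exact: (lreg_mul0 (unit_lreg two_unit)). Qed.

Lemma ftl_S_10 : ftl_S F (mnm2 1 0) = 0.
Proof.
have [c1 _ _] := ftl_coef_axis.
have [/(congr1 (fun f : mps R 2 => f (mnm2 1 0))) + _ _] := ftl_diag_coefs.
rewrite mps_pcomp_coef mps_diag_coef !big_ord_recl big_ord0.
rewrite ftl_coef_swap12 !c1 addr0 mps_coefD mulrC mps2_coefXM0 !addr0.
by move=> <-.
Qed.

(* The coefficients of [t^3] at [x^3] and then at [x y^2] in [F(x, x, y)] force the
   coefficient of [t^2] at [x y] to vanish; this is what makes [D] begin with [16 x^2]. *)
Lemma ftl_coef2_110 : F`_2 (mnm3 1 1 0) = 0.
Proof.
have [_ c2 c3] := ftl_coef_axis.
have c3_210 : F`_3 (mnm3 2 1 0) = 0.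
  have [_ _ /(congr1 (fun f : mps R 2 => f (mnm2 3 0)))] := ftl_diag_coefs.
  rewrite mps_pcomp_coef mps_diag_coef !big_ord_recr big_ord0 mps2_coefXM0.
  rewrite -[LHS]/(0 + F`_3 (mnm3 0 3 0) + F`_3 (mnm3 1 2 0) + F`_3 (mnm3 2 1 0)
    + F`_3 (mnm3 3 0 0)) (ftl_coef_swap12 3 0 3) (ftl_coef_swap12 3 1 2) c3.
  by rewrite !add0r addr0 -mulr2n -mulr_natl => /two_inj.
have P11 : ftl_P F (mnm2 1 1) = 0.
  have [_ _ /(congr1 (fun f : mps R 2 => f (mnm2 1 2)))] := ftl_diag_coefs.
  rewrite mps_pcomp_coef mps_diag_coef !big_ord_recr big_ord0.
  rewrite mps2_coefXM mps_coefD mps2_coefXM ftl_S_10 addr0.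
  rewrite -[LHS]/(0 + F`_3 (mnm3 0 1 2) + F`_3 (mnm3 1 0 2)) (ftl_coef_swap12 3 0 1).
  rewrite (ftl_coef_swap23 3 1 0) (ftl_coef_swap12 3 1 2) c3_210.
  by rewrite !addr0 two_natC mps_coefCM => /esym /two_inj.
(* At [x y] the coefficient of [t^2] is twice the wanted one by symmetry; on the factored side it
   combines [P11], [ftl_S_10] and the coefficient of [x] in [y], all zero. *)
have [_ /(congr1 (fun f : mps R 2 => f (mnm2 1 1))) + _] := ftl_diag_coefs.
rewrite mps_pcomp_coef mps_diag_coef !big_ord_recr big_ord0.
rewrite mps_coefD mps_coefD P11 two_natC mps_coefCM mps2_coefXM ftl_S_10 mps2_coefXM.
have -> : y (mnm2 1 0) = 0.
  by rewrite -[y]mulr1 mps2_coefXM0.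
rewrite -[LHS]/(0 + F`_2 (mnm3 0 1 1) + F`_2 (mnm3 1 0 1)) (ftl_coef_swap12 2 0 1).
rewrite (ftl_coef_swap23 2 1 0) mulr0 !add0r.
by rewrite -mulr2n -mulr_natl => /two_inj.
Qed.

(** The two pure squares contribute -2 each, and the mixed term vanishes by [ftl_coef2_110]. *)
Lemma ftl_P_20 : ftl_P F (mnm2 2 0) = - 4%:R.
Proof.
have [_ c2 _] := ftl_coef_axis.
have [_ /(congr1 (fun f : mps R 2 => f (mnm2 2 0))) + _] := ftl_diag_coefs.
rewrite mps_pcomp_coef mps_diag_coef !big_ord_recr big_ord0.
rewrite mps_coefD mps_coefD two_natC mps_coefCM !mps2_coefXM0 mulr0 !addr0 => <-.
rewrite -[LHS]/(0 + F`_2 (mnm3 0 2 0) + F`_2 (mnm3 1 1 0) + F`_2 (mnm3 2 0 0)).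
by rewrite (ftl_coef_swap12 2 0 2) c2 ftl_coef2_110; ring.
Qed.

Lemma mnm2_00 : mnm2 0 0 = 0%MM.
Proof.
by apply/mnmP => i; rewrite mnm0E (mnm_nth 0%N); case: i => [[|[|]]].
Qed.

Lemma mnm2_lin (m : 'X_{1..2}) : (mdeg m < 2)%N ->
  [\/ m = 0%MM, m = mnm2 1 0 | m = mnm2 0 1].
Proof.
rewrite [m]mnm2E; move: (m _) (m _) => a b.
rewrite -mnm2_00 mdegE !big_ord_recl big_ord0 addn0 ![mnm2 _ _ _](mnm_nth 0%N) /=.
by case: a b => [|[|a]] [|[|b]] // _; [apply: Or31 | apply: Or32 | apply: Or33].
Qed.

Lemma ftl_S_const : ftl_S F 0%MM = 0.
Proof.
have [S0 _] := @ftl_SP_0 1 0 (mps_coef0 _).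
have := mps_comp_const (ftl_S F) [tuple (0 : mps R 1); 0].
by rewrite S0 io0 mulr0 mps_coef0 => <-.
Qed.

(** [S = s1 y + T] with [T] of order 2, so [S^2] contributes nothing at [x^2] and only [-4 P]
    counts. *)
Lemma ftl_D_20 : ftl_D F (mnm2 2 0) = 16%:R.
Proof.
pose s1 := ftl_S F (mnm2 0 1); pose T := ftl_S F - mpsC s1 * y.
have y01 : y (mnm2 0 1) = 1 by rewrite -[y]mulr1 mps2_coefXM mnm2_00 /= eqxx.
have hT : ord_ge 2 T.
  move=> m /mnm2_lin[] ->; rewrite /T mps_coefB mps_coefCM.
  - by rewrite mpsX_const ftl_S_const mulr0 subr0.
  - by rewrite -[y]mulr1 mps2_coefXM0 ftl_S_10 mulr0 subr0.
  - by rewrite y01 mulr1 subrr.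
have SE : ftl_S F ^+ 2 = T * T + y * (mpsC (2%:R * s1) * T + mpsC s1 * (mpsC s1 * y)).
  by rewrite /T rmorphM rmorph_nat; ring.
rewrite mps_coefB SE mps_coefD mps2_coefXM0 (ord_geM hT hT); last first.
  by rewrite mdegE !big_ord_recl big_ord0 !(mnm_nth 0%N).
rewrite -(rmorph_nat (@mpsC R 2)) mps_coefCM ftl_P_20; ring.
Qed.

(** [D] vanishes at [x = 0], so [D = x D1]. With [iota(x) = x j], invariance of [D] gives
    [D1(x, y) = j D1(iota(x), y)]. As [j = -1] at [x = 0], [2 D1(0, y) = 0], and [x] divides [D1] as
    well. *)
Lemma ftl_D_factor : exists2 E : mps R 2, ftl_D F = x ^+ 2 * E & E 0%MM = 16%:R.
Proof.
have [x0 y0] : x 0%MM = 0 /\ y 0%MM = 0 by split; apply: mpsX_const.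
have killE f : mps_kill i0 f = mps_comp f [tuple 0; y].
  rewrite /mps_kill; congr mps_comp; apply: eq_from_tnth => i.
  by rewrite tnth_mktuple (tnth_nth 0); case: i => [[|[|]]].
have c0y : const_free [tuple 0; y] by apply: const_free2; rewrite ?mps_coef0.
have D0 : mps_kill i0 (ftl_D F) = 0.
  by rewrite killE ftl_D_comp //; have [-> ->] := ftl_SP_0 y0; ring.
have DE := mps_kill_eq0 D0; set D1 := mps_shift i0 (ftl_D F) in DE.
pose j := mps_comp (mps_shift ord0 iota) [tuple x].
have jE : io x = x * j.
  have hx := const_free1 x0.
  rewrite {1}[iota](@mps_shiftE _ _ ord0); last first.
    move=> m m0; rewrite (_ : m = 0%MM) ?iota_const //.
    by apply/mnmP => i; rewrite (ord1 i) m0 mnm0E.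
  by rewrite mps_compM // mps_compX // (tnth_nth 0).
have cxy : const_free [tuple io x; y] by apply: const_free2; rewrite ?io_const.
have D1E : D1 = j * mps_comp D1 [tuple io x; y].
  apply: (@mpsX_lreg _ _ i0); rewrite -DE mulrA -jE.
  rewrite -{1}[ftl_D F](mps_comp_var2) ftl_D_comp ?const_free2 //.
  have [<- <-] := ftl_SP_io x0 y0; rewrite -ftl_D_comp // DE mps_compM //.
  by rewrite mps_compX // (tnth_nth 0).
have kj : mps_kill i0 j = -1.
  rewrite killE mps_comp_comp1 // mps_compX // (tnth_nth 0) /=.
  have jc : mps_shift ord0 iota 0%MM = -1 by rewrite /= add0m iota_lin.
  rewrite -[mps_shift _ _](subrK (mpsC (-1))).
  rewrite -[LHS]/(mps_subst (const_free1 (mps_coef0 _)) _) rmorphD /= /mps_subst.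
  rewrite mps_compC mps_comp1_0 ?add0r ?rmorphN1 //.
  by rewrite mps_coefB jc /= eqxx subrr.
have D10 : mps_kill i0 D1 = 0.
  apply: (lreg_mul0 (@two_lreg 2)); rewrite mulr_natl mulr2n {2}D1E.
  rewrite [X in _ + X]killE mps_compM // -killE kj mps_comp_comp2 ?io_const //.
  rewrite mps_comp_comp1 // !mps_compX // !(tnth_nth 0) /= io0 -killE.
  by rewrite mulN1r subrr.
have D1E' := mps_kill_eq0 D10; exists (mps_shift i0 D1).
  by rewrite {1}DE {1}D1E' mulrA.
rewrite -ftl_D_20 -(mps_coefXnM i0 2) expr2 -mulrA -D1E' -DE; congr (ftl_D F _).
by apply/mnmP => i; rewrite mulmnE mnm1E (mnm_nth 0%N); case: i => [[|[|]]].
Qed.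

Lemma ftl_sqrtDP : ftl_sqrtD F ^+ 2 = ftl_D F /\
  forall m : 'X_{1..2}, (mdeg m < 2)%N -> ftl_sqrtD F m = (4%:R * x : mps R 2) m.
Proof.
apply: (@classical_sets.xgetPex _ 0 (fun s : mps R 2 => s ^+ 2 = ftl_D F /\
  forall m : 'X_{1..2}, (mdeg m < 2)%N -> s m = (4%:R * x : mps R 2) m)).
have [E DE E0] := ftl_D_factor.
(* The root of [D] will be [x V]. Here [16 = 4^2], and the inverse of twice 4 is the cube of the
   inverse of 2. *)
have [V V2 V0] : exists2 V : mps R 2, V ^+ 2 = E & V 0%MM = 4%:R.
  apply: (@mps_sqrt _ _ _ _ (2%:R^-1 ^+ 3)); first by rewrite E0; ring.
  rewrite (_ : 2%:R * 4%:R = 2%:R ^+ 3); last by ring.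
  by rewrite -exprMn mulVr // expr1n.
exists (x * V); split=> [|m hm]; first by rewrite exprMn V2 DE.
apply/eqP; rewrite -subr_eq0 -mps_coefB mulrC -mulrBl; apply/eqP.
apply: (@ord_geM _ _ 1 1) hm; apply: ord_ge1; last exact: mpsX_const.
by rewrite mps_coefB V0 -(rmorph_nat (@mpsC R 2)) /= eqxx subrr.
Qed.

Lemma mps_comp_lin2 p (f : mps R 2) (a b : mps R p) j : a 0%MM = 0 -> b 0%MM = 0 ->
  mps_comp f [tuple a; b] U_(j)%MM
  = f U_(i0)%MM * a U_(j)%MM + f U_(i1)%MM * b U_(j)%MM.
Proof.
move=> a0 b0; rewrite mps_comp_lin ?const_free2 // !big_ord_recl big_ord0 addr0.
rewrite (_ : ord0 = i0); last exact: val_inj.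
rewrite (_ : lift i0 ord0 = i1); last exact: val_inj.
by rewrite !(tnth_nth 0).
Qed.

(** Read off from [S(0, y) = 2 iota(y)]. *)
Lemma ftl_S_01 : ftl_S F U_(i1)%MM = - 2%:R.
Proof.
have y0 : y 0%MM = 0 by apply: mpsX_const.
have [/(congr1 (fun f : mps R 2 => f U_(i1)%MM)) + _] := ftl_SP_0 y0.
rewrite mps_comp_lin2 ?mps_coef0 // two_natC mps_coefCM io_lin // mulr0 add0r.
by rewrite mpsX_lin eqxx mulr1 mulrN1.
Qed.

Lemma mnm2_U0 : mnm2 1 0 = U_(i0)%MM.
Proof.
by apply/mnmP => i; rewrite mnm1E (mnm_nth 0%N); case: i => [[|[|]]].
Qed.

Lemma ftl_sqrtD_lin (i : 'I_2) : ftl_sqrtD F U_(i)%MM = 4%:R * (i0 == i)%:R.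
Proof.
have [_ ->] := ftl_sqrtDP; last by rewrite mdeg1.
by rewrite -(rmorph_nat (@mpsC R 2)) mps_coefCM mpsX_lin.
Qed.

Lemma ftl_sqrtD_const : ftl_sqrtD F 0%MM = 0.
Proof.
have [_ ->] := ftl_sqrtDP; last by rewrite mdeg0.
by rewrite -(rmorph_nat (@mpsC R 2)) mps_coefCM mpsX_const mulr0.
Qed.

Lemma ftl_B_const : ftl_B F 0%MM = 0.
Proof. by rewrite mps_coefCM mps_coefB ftl_S_const ftl_sqrtD_const subr0 mulr0. Qed.

Lemma mul_half_two (a : R) : 2%:R^-1 * (2%:R * a) = a.
Proof. by rewrite mulrA mulVr ?mul1r. Qed.

(** Together with [ftl_B_lin1]: [B] begins with [-2 x - y], hence [f] with [2 x + y]. Such linear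
    terms are what separates the roots later on. *)
Lemma ftl_B_lin0 : ftl_B F U_(i0)%MM = - 2%:R.
Proof.
rewrite mps_coefCM mps_coefB ftl_sqrtD_lin eqxx mulr1n -mnm2_U0 ftl_S_10.
by rewrite -[RHS]mul_half_two; congr (_ * _); ring.
Qed.

Lemma ftl_B_lin1 : ftl_B F U_(i1)%MM = - 1.
Proof.
rewrite mps_coefCM mps_coefB ftl_sqrtD_lin ftl_S_01 (_ : _ == _ = false) // mulr0n.
by rewrite -[RHS]mul_half_two; congr (_ * _); ring.
Qed.

Lemma two_pow_unit k : (2%:R : R) ^+ k \is a GRing.unit.
Proof. exact: unitrX. Qed.

(** The series and its image have the same square. Their difference has linear coefficient -8 in
    [x], so it is regular, and their sum vanishes. *)
Lemma ftl_sqrtD_io : mps_comp (ftl_sqrtD F) [tuple io x; y] = - ftl_sqrtD F.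
Proof.
have [x0 y0] : x 0%MM = 0 /\ y 0%MM = 0 by split; apply: mpsX_const.
have cxy : const_free [tuple io x; y] by apply: const_free2; rewrite ?io_const.
set W := ftl_sqrtD F; have [W2 _] := ftl_sqrtDP.
have W'2 : mps_comp W [tuple io x; y] ^+ 2 = W ^+ 2.
  rewrite -mps_compXn // W2.
  rewrite -{2}[ftl_D F]mps_comp_var2 !ftl_D_comp ?const_free2 ?io_const //.
  by have [-> ->] := ftl_SP_io x0 y0.
suff : mps_comp W [tuple io x; y] + W = 0 by move/eqP; rewrite addr_eq0 => /eqP.
apply: (@lreg_mul0 _ (mps_comp W [tuple io x; y] - W)); last first.
  by rewrite -subr_sqr W'2 subrr.
apply: (@mps_lreg_lin _ _ _ i0).
  by rewrite mps_coefB mps_comp_const ftl_sqrtD_const subrr.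
rewrite mps_coefB mps_comp_lin2 ?io_const // !ftl_sqrtD_lin eqxx io_lin // !mpsX_lin.
rewrite eqxx (_ : i0 == i1 = false) // mulr1n mulr0n (_ : _ - _ = - (2%:R ^+ 3)); last by ring.
by apply: unit_lreg; rewrite unitrN two_pow_unit.
Qed.

End SquareRoot.

Local Notation B2 a b := (mps_comp (ftl_B F) [tuple a; b]).
Local Notation f2 a b := (mps_comp (ftl_f iota F) [tuple a; b]).
Local Notation Ps a := (mps_comp Psi [tuple a]).

Lemma Psi_inverse : let g := comp_inverse Psi in
  [/\ g 0%MM = 0, mps_comp Psi [tuple g] = var 1 0 & mps_comp g [tuple Psi] = var 1 0].
Proof.
apply: (@comp_inverseP _ _ 1); first exact: framed_const frame.
by rewrite mul1r (framed_lin frame).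
Qed.

(** * Splitting on the diagonal, and the reflection axiom *)

Section Splitting.
Context {p : nat}.
Implicit Types a b c d e : mps R p.

Lemma Psi_point_const a : Ps a 0%MM = 0.
Proof. by rewrite mps_comp_const (framed_const frame). Qed.

Lemma Psi_point_lin a j : a 0%MM = 0 -> Ps a U_(j)%MM = a U_(j)%MM.
Proof.
move=> a0; rewrite mps_comp_lin ?const_free1 // big_ord1 (tnth_nth 0).
by rewrite (framed_lin frame) mul1r.
Qed.

Lemma Psi_pointK a : a 0%MM = 0 -> mps_comp (comp_inverse Psi) [tuple Ps a] = a.
Proof.
move=> a0; have ha := const_free1 a0; have [g0 _ gK] := Psi_inverse.
rewrite -mps_comp_comp1 ?(framed_const frame) // gK.
by rewrite mps_compX // (tnth_nth 0).
Qed.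

(** Expand [io (io a) = a] with [io = id - 2 Psi] and cancel 2: in the coordinate [Psi] the
    involution is negation. *)
Lemma Psi_point_io a : a 0%MM = 0 -> Ps (io a) = - Ps a.
Proof.
move=> a0; apply: (@two_lreg p).
have := io_Psi (io_const a); rewrite ioK //; move: (Ps (io a)) => u.
rewrite (io_Psi a0) => E.
have -> : 2%:R * u = a - 2%:R * Ps a - (a - 2%:R * Ps a - 2%:R * u) by ring.
by rewrite -E; ring.
Qed.

(** At the point [(Psi a, Psi b, Psi c)] the transported series has the images under [Psi] as its
    roots. Negating [Psi a] amounts to replacing [a] by [io a], and [t |-> -t] negates the roots. *)
Lemma ftl_point_reflect a b c r1 r2 r3 r4 s1 s2 s3 s4 :
  a 0%MM = 0 -> b 0%MM = 0 -> c 0%MM = 0 ->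
  const_free [tuple r1; r2; r3; r4] -> const_free [tuple s1; s2; s3; s4] ->
  F3 a b c = lin4 r1 r2 r3 r4 -> F3 (io a) b c = lin4 s1 s2 s3 s4 ->
  lin4 (Ps s1) (Ps s2) (Ps s3) (Ps s4)
  = lin4 (- Ps r1) (- Ps r2) (- Ps r3) (- Ps r4).
Proof.
move=> a0 b0 c0 hr hs E1 E2; have [H tH HE] := ftl_reflect FTL.
have [g0 Psig gPsi] := Psi_inverse.
(* Passing to the coordinates [Psi] of the point cancels the substitution of the inverse of [Psi]
   inside the transport. *)
have HP a' (r : 4.-tuple (mps R p)) : a' 0%MM = 0 -> const_free r ->
    F3 a' b c = \prod_(j < 4) lin (tnth r j) ->
    mps_pcomp H [tuple Ps a'; Ps b; Ps c] = \prod_(j < 4) lin (Ps (tnth r j)).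
  move=> a'0 hr' Er; have hP : const_free [tuple Ps a'; Ps b; Ps c].
    by apply: const_free3; apply: Psi_point_const.
  rewrite (rootwise_split tH hP hr').
    apply: eq_bigr => j _; have r0 := const_freeP _ hr' j; move: (tnth _ j) r0 => u u0.
    have hu : const_free [tuple of rcons [tuple Ps a'; Ps b; Ps c] u].
      by apply: const_free4 => //; apply: Psi_point_const.
    by rewrite mps_pcomp_lin // mps_comp_comp1 ?mpsX_const // mps_compX.
  rewrite -Er mps_pcomp_comp //; last first.
    by apply/const_freeP => i; rewrite tnth_mktuple mps_comp_const.
  congr mps_pcomp; apply: eq_from_tnth => i; rewrite !tnth_mktuple.
  rewrite mps_comp_comp1 ?mpsX_const // mps_compX //.
  by case: i => [[|[|[|]]]] // h; rewrite !(tnth_nth 0) /= Psi_pointK.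
have hPa : const_free [tuple Ps a; Ps b; Ps c].
  by apply: const_free3; apply: Psi_point_const.
have R1 := HP a [tuple r1; r2; r3; r4] a0 hr; rewrite -lin4_tuple in R1.
have R2 := HP (io a) [tuple s1; s2; s3; s4] (io_const a) hs; rewrite -lin4_tuple in R2.
have := congr1 (fun G => mps_pcomp G [tuple Ps a; Ps b; Ps c]) HE.
rewrite mps_pcomp_comp3 ?mps_coefN ?mpsX_const ?oppr0 // mps_compN // !mps_compX //.
rewrite !(tnth_nth 0) /= -Psi_point_io // R2 // !big_ord_recl big_ord0 !(tnth_nth 0) /=.
rewrite /lin4 mulr1 !mulrA => ->.
rewrite (mps_pcomp_subst hPa) map_comp_poly rmorphN /= map_polyX.
rewrite -[map_poly _ H]/(mps_pcomp H _) R1 // !big_ord_recl big_ord0 !(tnth_nth 0) /=.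
by rewrite mulr1 !rmorphM /= !rmorphD /= !rmorph1 !comp_polyZ !comp_polyX /lin4
  !scalerN !scaleNr !mulrA.
Qed.

Lemma ftl_B_point_const a b : B2 a b 0%MM = 0.
Proof. by rewrite mps_comp_const ftl_B_const. Qed.

Lemma ftl_B_point_lin a b j : a 0%MM = 0 -> b 0%MM = 0 ->
  B2 a b U_(j)%MM = - (2%:R * a U_(j)%MM) - b U_(j)%MM.
Proof.
by move=> a0 b0; rewrite mps_comp_lin2 // ftl_B_lin0 ftl_B_lin1; ring.
Qed.

Lemma ftl_point_sqrtD a b : a 0%MM = 0 -> b 0%MM = 0 ->
  mps_comp (ftl_sqrtD F) [tuple a; b] ^+ 2
  = mps_comp (ftl_S F) [tuple a; b] ^+ 2 - 4%:R * mps_comp (ftl_P F) [tuple a; b].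
Proof.
move=> a0 b0; have hab := const_free2 a0 b0; have [W2 _] := ftl_sqrtDP.
by rewrite -mps_compXn // W2 ftl_D_comp.
Qed.

Lemma ftl_point_B a b : a 0%MM = 0 -> b 0%MM = 0 ->
  2%:R * B2 a b = mps_comp (ftl_S F) [tuple a; b] - mps_comp (ftl_sqrtD F) [tuple a; b].
Proof.
move=> a0 b0; have hab := const_free2 a0 b0.
rewrite /ftl_B mps_compM // mps_compC mps_compB two_natC mulrA -rmorphM /=.
by rewrite mulrV // rmorph1 mul1r.
Qed.

(** The involution in [a] fixes [S] and changes the sign of the square root, so [B2 a b] and
    [B2 (io a) b] are the two roots of the quadratic factor. *)
Lemma ftl_point_B_io a b : a 0%MM = 0 -> b 0%MM = 0 ->
  2%:R * B2 (io a) b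
  = mps_comp (ftl_S F) [tuple a; b] + mps_comp (ftl_sqrtD F) [tuple a; b].
Proof.
move=> a0 b0; have hab := const_free2 a0 b0.
rewrite ftl_point_B ?io_const //; have [-> _] := ftl_SP_io a0 b0; congr (_ + _).
have := congr1 (fun g => mps_comp g [tuple a; b]) ftl_sqrtD_io.
rewrite mps_comp_comp2 ?io_const ?mpsX_const // mps_compN //.
rewrite mps_comp_comp1 ?mpsX_const // !mps_compX // !(tnth_nth 0) /= => ->.
by rewrite opprK.
Qed.

Lemma ftl_point_diag_split a b : a 0%MM = 0 -> b 0%MM = 0 ->
  F3 a a b = lin4 b b (B2 a b) (B2 (io a) b).
Proof.
move=> a0 b0; rewrite ftl_point_diag //.
have BS : mps_comp (ftl_S F) [tuple a; b] = B2 a b + B2 (io a) b.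
  apply: (@two_lreg p); rewrite mulrDr ftl_point_B // ftl_point_B_io //; ring.
have BP : mps_comp (ftl_P F) [tuple a; b] = B2 a b * B2 (io a) b.
  apply: (@two_lreg p); apply: (@two_lreg p).
  transitivity ((2%:R * B2 a b) * (2%:R * B2 (io a) b)); last by ring.
  rewrite ftl_point_B // ftl_point_B_io // mulrC -subr_sqr ftl_point_sqrtD //.
  by ring.
by rewrite BS BP /lin4 -!mul_polyC !rmorphM !rmorphD /=; ring.
Qed.

Lemma lreg_lin_sub a b j (u : R) : a 0%MM = 0 -> b 0%MM = 0 ->
  a U_(j)%MM - b U_(j)%MM = u -> u \is a GRing.unit -> GRing.lreg (a - b).
Proof.
move=> a0 b0 <- hu; apply: (@mps_lreg_lin _ _ _ j).
  by rewrite mps_coefB a0 b0 subrr.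
by rewrite mps_coefB; apply: unit_lreg.
Qed.

Lemma rev_eval_lin4 a b c d r :
  rev_eval 4 (lin4 a b c d) r = (r - a) * (r - b) * (r - c) * (r - d).
Proof.
rewrite /lin4 -!mulrA -[lin d]mulr1.
have s1 : (size (1%R : {poly mps R p}) <= 1)%N by rewrite size_poly1.
rewrite !rev_eval_linM ?size_linM // /rev_eval big_ord1 coef1 !mulr1.
by rewrite !mulrA.
Qed.

End Splitting.

(** Reflection at [(y, x, x)], where both values split. Cancelling the double factor that belongs to
    [y] leaves two equal quadratics, and linear terms decide which of the roots correspond to each
    other. *)
Lemma ftl_B_io_io : mps_comp (ftl_B F) [tuple io (var 2 0); io (var 2 1)]
  = mps_comp iota [tuple ftl_B F].
Proof.
pose x : mps R 2 := var 2 0; pose y : mps R 2 := var 2 1.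
have [x0 y0] : x 0%MM = 0 /\ y 0%MM = 0 by split; apply: mpsX_const.
have ix0 := io_const x; have iy0 := io_const y.
have Bc := ftl_B_point_const; have Pc := @Psi_point_const 2.
have E1 : F3 y x x = lin4 y y (B2 x y) (B2 (io x) y).
  by rewrite ftl_swap12 // ftl_swap23 // ftl_point_diag_split.
have E2 : F3 (io y) x x = lin4 (io y) (io y) (B2 x (io y)) (B2 (io x) (io y)).
  by rewrite ftl_swap12 // ftl_swap23 // ftl_point_diag_split.
have := ftl_point_reflect y0 x0 x0 (const_free4 y0 y0 (Bc _ x y) (Bc _ (io x) y))
  (const_free4 iy0 iy0 (Bc _ x (io y)) (Bc _ (io x) (io y))) E1 E2.
rewrite Psi_point_io // /lin4 -!mulrA => /poly_cancel-/(_ (lin_coef0 _)).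
move=> /poly_cancel-/(_ (lin_coef0 _)).
set b1 := Ps _; set b2 := Ps _; set c1 := - _; set c2 := - _.
(* Evaluation at the root [b2] yields [(b2 - c1) (b2 - c2) = 0]; the factor 1 only brings the
   products into the form of [rev_eval_linM]. *)
move=> /(congr1 (fun G => rev_eval 2 (G * 1) b2)).
rewrite -!mulrA !rev_eval_linM ?size_linM ?size_poly1 // subrr mul0r mulr0 => /esym E.
have c10 : c1 0%MM = 0 by rewrite /c1 mps_coefN Pc oppr0.
have c20 : c2 0%MM = 0 by rewrite /c2 mps_coefN Pc oppr0.
have r2 : GRing.lreg (b2 - c2).
  apply: (@lreg_lin_sub _ _ _ (@Ordinal 2 0 isT) (2%:R ^+ 2)); rewrite ?Pc //.
    rewrite /b2 /c2 mps_coefN !Psi_point_lin // !ftl_B_point_lin // !io_lin //.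
    by rewrite !mpsX_lin /=; ring.
  exact: two_pow_unit.
have b2E : b2 = c1.
  apply/eqP; rewrite -subr_eq0; apply/eqP; apply: (lreg_mul0 r2).
  by rewrite mulrC; move: E; rewrite /rev_eval big_ord1 coef1 !mulr1.
rewrite -[LHS]Psi_pointK // -/b2 b2E /c1 mps_comp_var2 -Psi_point_io ?ftl_B_const //.
by rewrite Psi_pointK // io_const.
Qed.

Local Notation two a := (mps_comp (ftl_two iota F) [tuple a]).
Local Notation half a := (mps_comp (ftl_half iota F) [tuple a]).
Local Notation mu a b := (mps_comp (ftl_mu iota F) [tuple a; b]).

(** * The series [f] and the doubling series *)

Section Halving.
Context {p : nat}.
Implicit Types a b c v : mps R p.

Let z0 : (0 : mps R p) 0%MM = 0 := mps_coef0 _.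
Let i0 := @io_const p.
Let Bc := @ftl_B_point_const p.

Lemma ftl_point_B_io_io a b : a 0%MM = 0 -> b 0%MM = 0 ->
  B2 (io a) (io b) = io (B2 a b).
Proof.
move=> a0 b0; have hab := const_free2 a0 b0.
have := congr1 (fun g => mps_comp g [tuple a; b]) ftl_B_io_io.
rewrite mps_comp_comp2 ?io_const // !mps_comp_comp1 ?mpsX_const ?ftl_B_const //.
by rewrite !mps_compX // !(tnth_nth 0).
Qed.

Lemma ftl_point_f a b : a 0%MM = 0 -> b 0%MM = 0 ->
  mps_comp (ftl_f iota F) [tuple a; b] = B2 (io a) (io b).
Proof.
move=> a0 b0; have hab := const_free2 a0 b0.
rewrite /ftl_f mps_comp_comp2 ?io_const // !mps_comp_comp1 ?mpsX_const //.
by rewrite !mps_compX // !(tnth_nth 0).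
Qed.

Lemma ftl_point_two a : a 0%MM = 0 -> two a = B2 (io a) 0.
Proof.
move=> a0; have ha := const_free1 a0.
rewrite /ftl_two mps_comp_comp2 ?mpsX_const ?mps_coef0 //.
have -> : mps_comp (0 : mps R 1) [tuple a] = 0 := rmorph0 (mps_subst ha).
by rewrite mps_compX // (tnth_nth 0) ftl_point_f // io0.
Qed.

End Halving.

Lemma ftl_two_const : ftl_two iota F 0%MM = 0.
Proof.
rewrite -(mps_comp_var1 (ftl_two iota F)) ftl_point_two ?mpsX_const //.
exact: ftl_B_point_const.
Qed.

Lemma ftl_two_lin : ftl_two iota F U_(ord0)%MM = 2%:R.
Proof.
rewrite -(mps_comp_var1 (ftl_two iota F)) ftl_point_two ?mpsX_const //.
rewrite ftl_B_point_lin ?io_const ?mps_coef0 // io_lin ?mpsX_const // mpsX_lin.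
by rewrite (_ : _ == _) // mulr1n; ring.
Qed.

Lemma ftl_halfP : let g := ftl_half iota F in
  [/\ g 0%MM = 0, mps_comp (ftl_two iota F) [tuple g] = var 1 0
    & mps_comp g [tuple ftl_two iota F] = var 1 0].
Proof.
apply: (@comp_inverseP _ _ 2%:R^-1); first exact: ftl_two_const.
by rewrite ftl_two_lin mulVr.
Qed.

(** * Halving, and the splitting of [F(x, 0, z)] *)

Section Halving.
Context {p : nat}.
Implicit Types a b c v : mps R p.

Let z0 : (0 : mps R p) 0%MM = 0 := mps_coef0 _.
Let i0 := @io_const p.
Let Bc := @ftl_B_point_const p.

Lemma half_const a : half a 0%MM = 0.
Proof. by rewrite mps_comp_const; have [] := ftl_halfP. Qed.

Lemma two_const a : two a 0%MM = 0.
Proof. by rewrite mps_comp_const ftl_two_const. Qed.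

Lemma halfK a : a 0%MM = 0 -> two (half a) = a.
Proof.
move=> a0; have ha := const_free1 a0; have [h0 th _] := ftl_halfP.
by rewrite -mps_comp_comp1 // th mps_compX // (tnth_nth 0).
Qed.

Lemma twoK a : a 0%MM = 0 -> half (two a) = a.
Proof.
move=> a0; have ha := const_free1 a0; have [h0 _ ht] := ftl_halfP.
by rewrite -mps_comp_comp1 ?ftl_two_const // ht mps_compX // (tnth_nth 0).
Qed.

Lemma half_lin a j : a 0%MM = 0 -> 2%:R * half a U_(j)%MM = a U_(j)%MM.
Proof.
move=> a0; rewrite -[in RHS](halfK a0) [RHS]mps_comp_lin ?const_free1 ?half_const //.
by rewrite big_ord1 (tnth_nth 0) ftl_two_lin.
Qed.

Lemma half0 : half (0 : mps R p) = 0.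
Proof. by apply: mps_comp1_0; have [] := ftl_halfP. Qed.

Lemma two_io a : a 0%MM = 0 -> two (io a) = io (two a).
Proof.
by move=> a0; rewrite !ftl_point_two // -ftl_point_B_io_io // io0.
Qed.

Lemma half_io a : a 0%MM = 0 -> half (io a) = io (half a).
Proof.
move=> a0; transitivity (half (io (two (half a)))); first by rewrite halfK.
by rewrite -two_io ?half_const // twoK.
Qed.

Lemma ftl_point_mu a b : a 0%MM = 0 -> b 0%MM = 0 -> mu a b = io (B2 (half a) b).
Proof.
move=> a0 b0; have hab := const_free2 a0 b0.
have [h0 _ _] := ftl_halfP.
rewrite /ftl_mu mps_comp_comp2 ?mps_comp_const ?mpsX_const //.
rewrite mps_comp_comp1 ?mpsX_const // !mps_compX // !(tnth_nth 0).
by rewrite ftl_point_f ?half_const // ftl_point_B_io_io ?half_const.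
Qed.

Lemma mu_const a b : a 0%MM = 0 -> b 0%MM = 0 -> mu a b 0%MM = 0.
Proof. by move=> a0 b0; rewrite ftl_point_mu. Qed.

(** Associativity at [(v, a, a, 0, 0)], with inner roots [v, v, B2 a v, B2 (io a) v] and
    [0, 0, b, io b]. After cancellation, the two factors left on the right coincide because an
    involution may be moved onto 0. *)
Lemma ftl_point_two_0 a v : a 0%MM = 0 -> v 0%MM = 0 ->
  F3 (two a) 0 v = lin4 (B2 a v) (B2 (io a) v) (B2 a (io v)) (B2 (io a) (io v)).
Proof.
move=> a0 v0; set b := B2 a 0; have b0 : b 0%MM = 0 by apply: Bc.
have ib : B2 (io a) 0 = io b by rewrite -[X in B2 _ X]io0 ftl_point_B_io_io.
have F0 (u : mps R p) : u 0%MM = 0 -> F3 u 0 0 = lin u ^+ 2 * lin (io u) ^+ 2.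
  exact: ftl_point_unit.
have E1 : F3 v a a = lin4 v v (B2 a v) (B2 (io a) v).
  by rewrite ftl_swap12 // ftl_swap23 // ftl_point_diag_split.
have E2 : F3 a a 0 = lin4 0 0 b (io b) by rewrite ftl_point_diag_split // ib.
have := ftl_point_assoc (const_free5 v0 a0 a0 z0 z0)
  (const_free4 v0 v0 (Bc a v) (Bc (io a) v)) (const_free4 z0 z0 b0 (i0 b)) E1 E2.
rewrite -!mulrA => /poly_cancel-/(_ (ftl_coef0 _ _ _)).
move=> /poly_cancel-/(_ (ftl_coef0 _ _ _)); rewrite !F0 // => E.
(* As [two a = io b], moving the involution onto 0 turns the left-hand side into [F3 b v 0]. *)
rewrite ftl_point_two // ib ftl_io12 // io0 ftl_swap23 //.
apply: sqr_poly_inj; [exact: two_lreg | exact: ftl_coef0 | |].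
  by rewrite /lin4 !coef0M !lin_coef0 !mulr1.
rewrite expr2 {1}(_ : F3 b v 0 = F3 v b 0); last by rewrite ftl_swap12.
have -> : F3 b v 0 = F3 v (io b) 0.
  by rewrite ftl_swap12 // ftl_io23 // io0.
rewrite -E /lin4 [B2 (io a) (io v)]ftl_point_B_io_io //.
by rewrite -[in B2 a (io v)](ioK a0) ftl_point_B_io_io //; ring.
Qed.

Lemma ftl_point_half_0 a v : a 0%MM = 0 -> v 0%MM = 0 ->
  F3 a 0 v = lin4 (B2 (half a) v) (B2 (io (half a)) v)
                  (B2 (half a) (io v)) (B2 (io (half a)) (io v)).
Proof. by move=> a0 v0; rewrite -[in LHS](halfK a0) ftl_point_two_0 // half_const. Qed.

End Halving.

(** * The group law: linear terms, commutativity, inverse and 2-series *)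

Lemma ftl_B_half_lin p (a b : mps R p) j : a 0%MM = 0 -> b 0%MM = 0 ->
  B2 (half a) b U_(j)%MM = - a U_(j)%MM - b U_(j)%MM.
Proof. by move=> a0 b0; rewrite ftl_B_point_lin ?half_const // half_lin. Qed.

Lemma ftl_B_io_half_lin p (a b : mps R p) j : a 0%MM = 0 -> b 0%MM = 0 ->
  B2 (io (half a)) b U_(j)%MM = a U_(j)%MM - b U_(j)%MM.
Proof. by move=> a0 b0; rewrite -half_io // ftl_B_half_lin ?io_const // io_lin // opprK. Qed.

Lemma mu_lin p (a b : mps R p) j : a 0%MM = 0 -> b 0%MM = 0 ->
  mu a b U_(j)%MM = a U_(j)%MM + b U_(j)%MM.
Proof.
move=> a0 b0; rewrite ftl_point_mu // io_lin ?ftl_B_point_const // ftl_B_half_lin //.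
by ring.
Qed.

Lemma mu_B p (a b : mps R p) : a 0%MM = 0 -> b 0%MM = 0 ->
  mu a b = B2 (io (half a)) (io b).
Proof. by move=> a0 b0; rewrite ftl_point_mu // ftl_point_B_io_io ?half_const. Qed.

Lemma mu_io p (a b : mps R p) : a 0%MM = 0 -> b 0%MM = 0 ->
  mu (io a) (io b) = io (mu a b).
Proof.
move=> a0 b0; rewrite (mu_B (io_const a) (io_const b)) (ftl_point_mu a0 b0) half_io //.
by rewrite !ftl_point_B_io_io ?io_const ?half_const.
Qed.

(** [mu a b] is [B2 (io (half a)) (io b)], a root of [F3 a 0 b = F3 b 0 a]. The factors are its
    differences from the four roots of the latter, the last of which is [mu b a]. *)
Lemma mu_root p (a b : mps R p) : a 0%MM = 0 -> b 0%MM = 0 ->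
  (mu a b - B2 (half b) a) * ((mu a b - B2 (io (half b)) a)
    * ((mu a b - B2 (half b) (io a)) * (mu a b - mu b a))) = 0.
Proof.
move=> a0 b0; have z0 : (0 : mps R p) 0%MM = 0 := mps_coef0 _.
have E : F3 a 0 b = F3 b 0 a.
  by rewrite (ftl_swap12 a0 z0 b0) (ftl_swap23 z0 a0 b0) (ftl_swap12 z0 b0 a0).
have := rev_eval_lin4 (B2 (half a) b) (B2 (io (half a)) b) (B2 (half a) (io b))
  (mu a b) (mu a b).
rewrite subrr mulr0 {1}(mu_B a0 b0) -(ftl_point_half_0 a0 b0) E.
by rewrite (ftl_point_half_0 b0 a0) -(mu_B b0 a0) rev_eval_lin4 -!mulrA.
Qed.

(** In [mu_root] each of the first three differences has linear coefficient 2 in [x] or in [y], so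
    it can be cancelled. *)
Lemma mu_varC : mu (var 2 0) (var 2 1) = mu (var 2 1) (var 2 0).
Proof.
have x0 : (var 2 0 : mps R 2) 0%MM = 0 by apply: mpsX_const.
have y0 : (var 2 1 : mps R 2) 0%MM = 0 by apply: mpsX_const.
move: (mu_root x0 y0).
have [x10 x11 y10 y11] : [/\ (var 2 0 : mps R 2) U_(@Ordinal 2 0 isT)%MM = 1,
    (var 2 0 : mps R 2) U_(@Ordinal 2 1 isT)%MM = 0,
    (var 2 1 : mps R 2) U_(@Ordinal 2 0 isT)%MM = 0
  & (var 2 1 : mps R 2) U_(@Ordinal 2 1 isT)%MM = 1].
  by split; rewrite mpsX_lin.
move: (var 2 0 : mps R 2) (var 2 1 : mps R 2) x0 y0 x10 x11 y10 y11.
move=> x y x0 y0 x10 x11 y10 y11.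
have Bc := @ftl_B_point_const 2; have mc := mu_const x0 y0.
have two1 := two_pow_unit 1.
have l1 : GRing.lreg (mu x y - B2 (half y) x).
  apply: (@lreg_lin_sub _ _ _ (@Ordinal 2 0 isT) (2%:R ^+ 1)) => //.
  by rewrite (mu_lin _ x0 y0) (ftl_B_half_lin _ y0 x0) x10 y10; ring.
have l2 : GRing.lreg (mu x y - B2 (io (half y)) x).
  apply: (@lreg_lin_sub _ _ _ (@Ordinal 2 0 isT) (2%:R ^+ 1)) => //.
  by rewrite (mu_lin _ x0 y0) (ftl_B_io_half_lin _ y0 x0) x10 y10; ring.
have l3 : GRing.lreg (mu x y - B2 (half y) (io x)).
  apply: (@lreg_lin_sub _ _ _ (@Ordinal 2 1 isT) (2%:R ^+ 1)) => //.
  by rewrite (mu_lin _ x0 y0) (ftl_B_half_lin _ y0 (io_const x)) (io_lin _ x0) x11 y11; ring.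
move=> /(lreg_mul0 l1)/(lreg_mul0 l2)/(lreg_mul0 l3)/eqP.
by rewrite subr_eq0 => /eqP.
Qed.

Section GroupLaw.
Context {p : nat}.
Implicit Types a b : mps R p.

Lemma muC a b : a 0%MM = 0 -> b 0%MM = 0 -> mu a b = mu b a.
Proof.
move=> a0 b0; have hab := const_free2 a0 b0.
have x0 : (var 2 0 : mps R 2) 0%MM = 0 by apply: mpsX_const.
have y0 : (var 2 1 : mps R 2) 0%MM = 0 by apply: mpsX_const.
have := congr1 (fun g => mps_comp g [tuple a; b]) mu_varC.
rewrite (mps_comp_comp2 (ftl_mu iota F) x0 y0 hab) (mps_comp_comp2 (ftl_mu iota F) y0 x0 hab).
by rewrite !(mps_compX _ hab) !(tnth_nth 0).
Qed.

Lemma Psi_point_inj a : a 0%MM = 0 -> Ps a = 0 -> a = 0.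
Proof.
move=> a0 Pa; rewrite -[LHS]Psi_pointK // Pa mps_comp1_0 //.
by have [] := Psi_inverse.
Qed.

(* [mu a (io a)] is fixed by [io], and the only fixed point of [io] is [0]. *)
Lemma mu_inv a : a 0%MM = 0 -> mu a (io a) = 0.
Proof.
move=> a0; have c0 := mu_const a0 (io_const a); apply: Psi_point_inj => //.
apply: (lreg_mul0 (@two_lreg p)).
have : io (mu a (io a)) = mu a (io a).
  by rewrite -(mu_io a0 (io_const a)) (ioK a0) (muC (io_const a) a0).
rewrite (io_Psi c0) => /eqP; rewrite subr_eq addrC -subr_eq subrr.
by move/eqP.
Qed.

Lemma mu_invl a : a 0%MM = 0 -> mu (io a) a = 0.
Proof. by move=> a0; rewrite (muC (io_const a) a0) mu_inv. Qed.

End GroupLaw.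

(** [[2](x)] is a root of [F3 x x 0 = F3 x 0 x], whose roots are [B2 (half x) x], [0], [0] and
    [mu x x]; the zeros come from [mu_inv]. It differs from the first three by series with linear
    coefficients 4, 2 and 2. *)
Lemma ftl_two_series : ftl_two iota F = two_series (ftl_mu iota F).
Proof.
pose x : mps R 1 := var 1 0; have x0 : x 0%MM = 0 by apply: mpsX_const.
have z0 : (0 : mps R 1) 0%MM = 0 := mps_coef0 _.
rewrite /two_series -/x -[LHS]mps_comp_var1 -/x.
have tc := two_const x; have mc := mu_const x0 x0.
have xl : x U_(ord0)%MM = 1 by rewrite mpsX_lin.
move: x x0 xl tc mc => x x0 xl tc mc; have hc := half_const x; have Bc := @ftl_B_point_const 1.
have E : F3 x 0 x = F3 x x 0 by rewrite (ftl_swap23 x0 z0 x0).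
have B1 : B2 (io (half x)) x = 0.
  by rewrite -[X in B2 _ X](ioK x0) -(mu_B x0 (io_const x)) (mu_inv x0).
have B3 : B2 (half x) (io x) = 0.
  by rewrite -[X in B2 X _](ioK hc) (ftl_point_B_io_io (io_const _) x0) B1 io0.
have := rev_eval_lin4 0 0 (B2 x 0) (two x) (two x).
rewrite subrr mulr0 {1}(ftl_point_two x0) -(ftl_point_diag_split x0 z0) -E.
rewrite (ftl_point_half_0 x0 x0) rev_eval_lin4 -(mu_B x0 x0) B1 B3 !subr0.
have tl : two x U_(ord0)%MM = 2%:R.
  rewrite (ftl_point_two x0) (ftl_B_point_lin _ (io_const x) z0) (io_lin _ x0) xl mps_coef0.
  by ring.
have l0 : GRing.lreg (two x).
  rewrite -[two x]subr0; apply: (@lreg_lin_sub _ _ _ ord0 (2%:R ^+ 1)) => //.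
  by rewrite tl mps_coef0 subr0.
have l1 : GRing.lreg (two x - B2 (half x) x).
  apply: (@lreg_lin_sub _ _ _ ord0 (2%:R ^+ 2)) => //.
    by rewrite tl (ftl_B_half_lin _ x0 x0) xl; ring.
  exact: two_pow_unit.
rewrite -!mulrA => /(lreg_mul0 l1)/(lreg_mul0 l0)/(lreg_mul0 l0)/eqP.
by rewrite subr_eq0 => /eqP.
Qed.

Lemma mu_diag p (a : mps R p) : a 0%MM = 0 -> mu a a = two a.
Proof.
move=> a0; have ha := const_free1 a0; rewrite ftl_two_series /two_series.
have x0 : (var 1 0 : mps R 1) 0%MM = 0 by apply: mpsX_const.
by rewrite (mps_comp_comp2 (ftl_mu iota F) x0 x0 ha) (mps_compX _ ha) (tnth_nth 0).
Qed.

(** Associativity at [(a, b, 0, 0, c)]: the roots of [F3 a b 0] are [mu a b], [mu a (io b)] and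
    their images under [io]. Moving these involutions onto 0 makes both sides squares. *)
Lemma ftl_point_product p (a b c : mps R p) :
  a 0%MM = 0 -> b 0%MM = 0 -> c 0%MM = 0 ->
  F3 a b c * F3 a (io b) c = F3 (mu a b) 0 c * F3 (mu a (io b)) 0 c.
Proof.
move=> a0 b0 c0; have z0 : (0 : mps R p) 0%MM = 0 := mps_coef0 _.
have ib0 := io_const b; have p0 := mu_const a0 b0; have q0 := mu_const a0 ib0.
have ip0 := io_const (mu a b); have iq0 := io_const (mu a (io b)).
have h0 := half_const a.
have E1 : F3 a b 0 = lin4 (io (mu a b)) (mu a (io b)) (io (mu a (io b))) (mu a b).
  have pE : io (mu a b) = B2 (half a) b.
    by rewrite (ftl_point_mu a0 b0) ioK ?ftl_B_point_const.
  have qE : mu a (io b) = B2 (io (half a)) b by rewrite (mu_B a0 ib0) (ioK b0).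
  have iqE : io (mu a (io b)) = B2 (half a) (io b).
    by rewrite (ftl_point_mu a0 ib0) ioK ?ftl_B_point_const.
  by rewrite (ftl_swap23 a0 b0 z0) (ftl_point_half_0 a0 b0) pE iqE qE (mu_B a0 b0).
have E2 : F3 b 0 0 = lin4 b b (io b) (io b).
  by rewrite (ftl_point_unit b0) /lin4 !expr2 !mulrA.
have := ftl_point_assoc (const_free5 a0 b0 z0 z0 c0) (const_free4 ip0 q0 iq0 p0)
  (const_free4 b0 b0 ib0 ib0) E1 E2.
rewrite (ftl_io12 p0 z0 c0) (ftl_io12 q0 z0 c0) io0 => E.
apply: sqr_poly_inj; rewrite ?coef0M ?ftl_coef0 ?mulr1 //; first exact: two_lreg.
by rewrite !exprMn !expr2 !mulrA -E; ring.
Qed.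

(** * The four roots of [F(x, y, z)] *)

Lemma rev_eval_half_0 p (a v : mps R p) : a 0%MM = 0 -> v 0%MM = 0 ->
  [/\ rev_eval 4 (F3 a 0 v) (B2 (half a) v) = 0,
      rev_eval 4 (F3 a 0 v) (B2 (io (half a)) v) = 0,
      rev_eval 4 (F3 a 0 v) (B2 (half a) (io v)) = 0
    & rev_eval 4 (F3 a 0 v) (B2 (io (half a)) (io v)) = 0].
Proof.
move=> a0 v0; rewrite (ftl_point_half_0 a0 v0) !rev_eval_lin4.
by split; rewrite subrr ?(mulr0, mul0r).
Qed.

(* The factor [F x (io y) z] splits explicitly after restriction to [x = y]. *)
Lemma rev_eval_lreg_diag (r : mps R 3) (y := var 3 1 : mps R 3) (z := var 3 2 : mps R 3)
    (r' := mps_comp r [tuple y; y; z]) :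
  GRing.lreg (r' - io z) -> GRing.lreg (r' - B2 y (io z)) ->
  GRing.lreg (r' - B2 (io y) (io z)) ->
  GRing.lreg (rev_eval 4 (F3 (var 3 0) (io (var 3 1)) (var 3 2)) r).
Proof.
move=> l1 l2 l3; apply: mps_lreg_diag.
have x0 : (var 3 0 : mps R 3) 0%MM = 0 by apply: mpsX_const.
have y0 : y 0%MM = 0 by apply: mpsX_const.
have z0 : z 0%MM = 0 by apply: mpsX_const.
have hd := const_free3 y0 y0 z0; rewrite (mps_comp_rev_eval hd).
rewrite (mps_pcomp_comp3 _ x0 (io_const y) z0 hd) (mps_comp_comp1 _ y0 hd).
rewrite !(mps_compX _ hd) !(tnth_nth 0) /= -/y -/z -/r'.
rewrite (ftl_io23 y0 y0 z0) (ftl_point_diag_split y0 (io_const z)) rev_eval_lin4.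
by do 3?[apply: lregM].
Qed.

Section Roots.

Let x : mps R 3 := var 3 0.
Let y : mps R 3 := var 3 1.
Let z : mps R 3 := var 3 2.
Let s := half (mu x y).
Let r := half (mu x (io y)).

(** On [x = y], halving [mu(y, y) = [2](y)] gives [y], while [mu(y, iota(y)) = 0]. *)
Lemma ftl_restrict_half_mu (d := [tuple y; y; z]) :
  mps_comp s d = y /\ mps_comp r d = 0.
Proof.
have x0 : x 0%MM = 0 by apply: mpsX_const.
have y0 : y 0%MM = 0 by apply: mpsX_const.
have z0 : z 0%MM = 0 by apply: mpsX_const.
have hd : const_free d := const_free3 y0 y0 z0; have iy0 := io_const y.
have xd : mps_comp x d = y by rewrite (mps_compX _ hd) (tnth_nth 0).
have yd : mps_comp y d = y by rewrite (mps_compX _ hd) (tnth_nth 0).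
split.
  rewrite /s (mps_comp_comp1 _ (mu_const x0 y0) hd) (mps_comp_comp2 _ x0 y0 hd) xd yd.
  by rewrite (mu_diag y0) (twoK y0).
rewrite /r (mps_comp_comp1 _ (mu_const x0 iy0) hd) (mps_comp_comp2 _ x0 iy0 hd) xd.
by rewrite (mps_comp_comp1 _ y0 hd) yd (mu_inv y0) half0.
Qed.

Lemma lreg_sub_two p (a b : mps R p) j : a 0%MM = 0 -> b 0%MM = 0 ->
  a U_(j)%MM - b U_(j)%MM = 2%:R \/ a U_(j)%MM - b U_(j)%MM = - 2%:R ->
  GRing.lreg (a - b).
Proof.
by move=> a0 b0 [] /(lreg_lin_sub a0 b0); apply; rewrite ?unitrN.
Qed.

(** By [ftl_point_product] the hypothesis says that [u] is a root of the product of [F3 a b c] and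
    [F3 a (io b) c]; the regular value of the second factor cancels. *)
Lemma ftl_point_root p (a b c u : mps R p) :
  a 0%MM = 0 -> b 0%MM = 0 -> c 0%MM = 0 ->
  rev_eval 4 (F3 (mu a b) 0 c) u * rev_eval 4 (F3 (mu a (io b)) 0 c) u = 0 ->
  GRing.lreg (rev_eval 4 (F3 a (io b) c) u) -> rev_eval 4 (F3 a b c) u = 0.
Proof.
move=> a0 b0 c0; rewrite -(rev_evalM u (ftl_size _ _ _) (ftl_size _ _ _)).
rewrite -(ftl_point_product a0 b0 c0) (rev_evalM u (ftl_size _ _ _) (ftl_size _ _ _)).
by rewrite mulrC => E /lreg_mul0; apply.
Qed.

Lemma ftl_split : F = lin4 (B2 s z) (B2 (io s) z) (B2 r (io z)) (B2 (io r) (io z)).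
Proof.
pose j0 := @Ordinal 3 0 isT; pose j1 := @Ordinal 3 1 isT; pose j2 := @Ordinal 3 2 isT.
have x0 : x 0%MM = 0 by apply: mpsX_const.
have y0 : y 0%MM = 0 by apply: mpsX_const.
have z0 : z 0%MM = 0 by apply: mpsX_const.
have iy0 := io_const y; have iz0 := io_const z; have Bc := @ftl_B_point_const 3.
have p0 := mu_const x0 y0; have q0 := mu_const x0 iy0.
have s0 := half_const (mu x y); have r0 := half_const (mu x (io y)).
have hd := const_free3 y0 y0 z0.
have yd : mps_comp y [tuple y; y; z] = y by rewrite (mps_compX _ hd) (tnth_nth 0).
have zd : mps_comp z [tuple y; y; z] = z by rewrite (mps_compX _ hd) (tnth_nth 0).
have [sd rd] := ftl_restrict_half_mu.
(* The four candidates begin with [-x - y - z], [x + y - z], [-x + y + z] and [x - y + z]. *)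
have l1 j : B2 s z U_(j)%MM = - (x U_(j)%MM + y U_(j)%MM) - z U_(j)%MM.
  by rewrite (ftl_B_half_lin _ p0 z0) (mu_lin _ x0 y0).
have l2 j : B2 (io s) z U_(j)%MM = x U_(j)%MM + y U_(j)%MM - z U_(j)%MM.
  by rewrite (ftl_B_io_half_lin _ p0 z0) (mu_lin _ x0 y0).
have l3 j : B2 r (io z) U_(j)%MM = - (x U_(j)%MM - y U_(j)%MM) + z U_(j)%MM.
  by rewrite (ftl_B_half_lin _ q0 iz0) (mu_lin _ x0 iy0) !io_lin // opprK.
have l4 j : B2 (io r) (io z) U_(j)%MM = x U_(j)%MM - y U_(j)%MM + z U_(j)%MM.
  by rewrite (ftl_B_io_half_lin _ q0 iz0) (mu_lin _ x0 iy0) !io_lin // opprK.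
have [s1 s2 _ _] := rev_eval_half_0 p0 z0.
have [_ _ r3 r4] := rev_eval_half_0 q0 z0.
have rootE (u : mps R 3) := @ftl_point_root 3 x y z u x0 y0 z0.
have bl (a : mps R 3) j : a 0%MM = 0 -> B2 a (io z) U_(j)%MM = - (2%:R * a U_(j)%MM) + z U_(j)%MM.
  by move=> a0; rewrite (ftl_B_point_lin _ a0 iz0) (io_lin _ z0) opprK.
have zl j : io z U_(j)%MM = - z U_(j)%MM := io_lin j z0.
have yl j : io y U_(j)%MM = - y U_(j)%MM := io_lin j y0.
(* [B2 s z] is a root of the factor that belongs to [mu x y]. On [x = y] it restricts to [B2 y z],
   which has to be separated from the roots of [F3 y y (io z)]. *)
have e1 : rev_eval 4 (F3 x y z) (B2 s z) = 0.
  apply: rootE; first by rewrite s1 mul0r.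
  apply: rev_eval_lreg_diag; rewrite (mps_comp_comp2 _ s0 z0 hd) sd zd.
  - apply: (lreg_sub_two (j := j1) (Bc _ _) iz0); right.
    by rewrite (ftl_B_point_lin _ y0 z0) zl !mpsX_lin /=; ring.
  - apply: (lreg_sub_two (j := j2) (Bc _ _) (Bc _ _)); right.
    by rewrite (ftl_B_point_lin _ y0 z0) (bl _ _ y0) !mpsX_lin /=; ring.
  - apply: (lreg_sub_two (j := j2) (Bc _ _) (Bc _ _)); right.
    by rewrite (ftl_B_point_lin _ y0 z0) (bl _ _ iy0) yl !mpsX_lin /=; ring.
have e2 : rev_eval 4 (F3 x y z) (B2 (io s) z) = 0.
  apply: rootE; first by rewrite s2 mul0r.
  apply: rev_eval_lreg_diag;
    rewrite (mps_comp_comp2 _ (io_const s) z0 hd) (mps_comp_comp1 _ s0 hd) sd zd.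
  - apply: (lreg_sub_two (j := j1) (Bc _ _) iz0); left.
    by rewrite (ftl_B_point_lin _ iy0 z0) yl zl !mpsX_lin /=; ring.
  - apply: (lreg_sub_two (j := j2) (Bc _ _) (Bc _ _)); right.
    by rewrite (ftl_B_point_lin _ iy0 z0) (bl _ _ y0) yl !mpsX_lin /=; ring.
  - apply: (lreg_sub_two (j := j2) (Bc _ _) (Bc _ _)); right.
    by rewrite (ftl_B_point_lin _ iy0 z0) (bl _ _ iy0) yl !mpsX_lin /=; ring.
have n0 : (0 : mps R 3) 0%MM = 0 := mps_coef0 _.
(* Since [r] restricts to 0 on [x = y], the third and the fourth candidates both restrict to
   [B2 0 (io z)], so one computation serves both. *)
have d3 : let t := B2 0 (io z) in [/\ GRing.lreg (t - io z),
    GRing.lreg (t - B2 y (io z)) & GRing.lreg (t - B2 (io y) (io z))].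
  split.
  - apply: (lreg_sub_two (j := j2) (Bc _ _) iz0); left.
    by rewrite (bl _ _ n0) zl mps_coef0 !mpsX_lin /=; ring.
  - apply: (lreg_sub_two (j := j1) (Bc _ _) (Bc _ _)); left.
    by rewrite (bl _ _ n0) (bl _ _ y0) mps_coef0 !mpsX_lin /=; ring.
  - apply: (lreg_sub_two (j := j1) (Bc _ _) (Bc _ _)); right.
    by rewrite (bl _ _ n0) (bl _ _ iy0) yl mps_coef0 !mpsX_lin /=; ring.
have e3 : rev_eval 4 (F3 x y z) (B2 r (io z)) = 0.
  have [d31 d32 d33] := d3; apply: rootE; first by rewrite r3 mulr0.
  by apply: rev_eval_lreg_diag;
    rewrite (mps_comp_comp2 _ r0 iz0 hd) (mps_comp_comp1 _ z0 hd) rd zd.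
have e4 : rev_eval 4 (F3 x y z) (B2 (io r) (io z)) = 0.
  have [d31 d32 d33] := d3; apply: rootE; first by rewrite r4 mulr0.
  by apply: rev_eval_lreg_diag; rewrite (mps_comp_comp2 _ (io_const r) iz0 hd)
    (mps_comp_comp1 _ r0 hd) (mps_comp_comp1 _ z0 hd) rd zd io0.
have FE : F3 x y z = F.
  by apply/polyP => k; rewrite mps_pcomp_coef mps_comp_var3.
(* For each of the six differences, [j] names a variable in which its linear coefficient is 2. *)
rewrite -[LHS]FE; apply: lin_prod4_of_roots => //; rewrite ?ftl_coef0 ?ftl_size //.
- apply: (lreg_sub_two (j := j0) (Bc _ _) (Bc _ _)); left.
  by rewrite l2 l1 !mpsX_lin /=; ring.
- apply: (lreg_sub_two (j := j1) (Bc _ _) (Bc _ _)); left.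
  by rewrite l3 l1 !mpsX_lin /=; ring.
- apply: (lreg_sub_two (j := j0) (Bc _ _) (Bc _ _)); left.
  by rewrite l4 l1 !mpsX_lin /=; ring.
- apply: (lreg_sub_two (j := j2) (Bc _ _) (Bc _ _)); left.
  by rewrite l3 l2 !mpsX_lin /=; ring.
- apply: (lreg_sub_two (j := j2) (Bc _ _) (Bc _ _)); left.
  by rewrite l4 l2 !mpsX_lin /=; ring.
- apply: (lreg_sub_two (j := j0) (Bc _ _) (Bc _ _)); left.
  by rewrite l4 l3 !mpsX_lin /=; ring.
Qed.

End Roots.

Lemma mu_formal_inverse : is_formal_inverse (ftl_mu iota F) iota.
Proof.
have x0 : (var 1 0 : mps R 1) 0%MM = 0 by apply: mpsX_const.
split; first exact: iota_const.
  by have := mu_inv x0; rewrite (mps_comp_var1 iota).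
by have := mu_invl x0; rewrite (mps_comp_var1 iota).
Qed.

End TernaryLaw.

Theorem corollary8p4p6 (R : comUnitRingType) (A : grading R)
    (two_unit : (2%:R : R) \is a GRing.unit)
    (iota Psi : mps R 1) (F : {poly (mps R 3)})
    (FTL : formal_ternary_law A iota Psi F) :
  let B (a b : mps R 3) := mps_comp (ftl_B F) [tuple a; b] in
  let mu (a b : mps R 3) := mps_comp (ftl_mu iota F) [tuple a; b] in
  let half (a : mps R 3) := mps_comp (ftl_half iota F) [tuple a] in
  let inv (a : mps R 3) := mps_comp iota [tuple a] in
  let x : mps R 3 := var 3 0 in
  let y : mps R 3 := var 3 1 in
  let z : mps R 3 := var 3 2 in
  let p := mu x y in
  let q := mu x (inv y) in
  let s := half p in
  let r := half q in
  [/\ F = (1 + B s z *: 'X) * (1 + B (inv s) z *: 'X)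
          * (1 + B r (inv z) *: 'X) * (1 + B (inv r) (inv z) *: 'X),
      is_formal_inverse (ftl_mu iota F) iota
    & ftl_two iota F = two_series (ftl_mu iota F)].
Proof.
split.
- exact: (ftl_split two_unit FTL).
- exact: (mu_formal_inverse two_unit FTL).
- exact: (ftl_two_series two_unit FTL).
Qed.
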